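(* Let $\mathbb{K}$ be an algebraically closed field of characteristic zero, and let $X(A)$ be a trinomial variety over $\mathbb{K}$ (of type 1 or type 2), with canonical decomposition $X(A)\cong Y(A)\times\mathbb{A}^m$. If the variety $Y(A)$ is not rigid, then the number of $\mathrm{Aut}(X(A))$-orbits on $X(A)$ is finite.
   Context: Trinomial varieties. Fix positive integers $r,n$, an integer $m\ge 0$, $q\in\{0,1\}$, and a partition $n=n_q+\dots+n_r$ into positive integers. Let $B=\mathbb{K}[T_{ij},S_k \mid q\le i\le r,\ 1\le j\le n_i,\ 1\le k\le m]$ be the polynomial algebra in $n+m$ variables. For each $i=q,\dots,r$ fix a tuple of positive integers $l_i=(l_{i1},\dots,l_{in_i})$ and put $T_i^{l_i}=T_{i1}^{l_{i1}}\cdots T_{in_i}^{l_{in_i}}\in B$. Type 1: $q=1$, $A=(a_1,\dots,a_r)$ with $a_i\in\mathbb{K}$ pairwise distinct, $I=\{1,\dots,r-1\}$, and $g_i=T_i^{l_i}-T_{i+1}^{l_{i+1}}-(a_{i+1}-a_i)$ for $i\in I$. Type 2: $q=0$, $A=\begin{pmatrix}a_{10}&a_{11}&\cdots&a_{1r}\\ a_{20}&a_{21}&\cdots&a_{2r}\end{pmatrix}$ is a matrix over $\mathbb{K}$ any two columns of which are linearly independent, $I=\{0,\dots,r-2\}$, and $g_i=\det\begin{pmatrix}T_i^{l_i}&T_{i+1}^{l_{i+1}}&T_{i+2}^{l_{i+2}}\\ a_{1,i}&a_{1,i+1}&a_{1,i+2}\\ a_{2,i}&a_{2,i+1}&a_{2,i+2}\end{pmatrix}$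 for $i\in I$. In both cases $R(A)=B/(g_i\mid i\in I)$ is the trinomial algebra, and $X(A)=\mathrm{Spec}\,R(A)$ is the trinomial variety. $Y(A)$ is the trinomial variety given by the same data but without the variables $S_k$ (i.e. with $m$ replaced by $0$), so $X(A)\cong Y(A)\times\mathbb{A}^m$. A derivation of a $\mathbb{K}$-algebra is locally nilpotent (an LND) if each element is annihilated by some power of it. An affine variety $V$ is rigid if $\mathbb{K}[V]$ admits no nonzero LND. $\mathrm{Aut}(V)$ denotes the group of regular automorphisms of $V$. *)

(* Defs.v *)
From HB Require Import structures.
From mathcomp Require Import all_boot all_order all_algebra.
From mathcomp Require Import boolp ring.
From mathcomp Require Import mpoly.

Set Implicit Arguments.
Unset Strict Implicit.
Unset Printing Implicit Defensive.

Import GRing.Theory.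
Local Open Scope ring_scope.
Local Open Scope quotient_scope.

(* MathComp's quotient of a ring by a proper ideal is only a ring; when the
   ring is a K-algebra, the quotient gets the induced K-algebra structure. *)
Section QuotientAlgebra.
Variables (K : comNzRingType) (B : comAlgType K) (I : idealr B).
Local Notation Q := {ideal_quot I}.

Definition quot_scale (c : K) (x : Q) : Q := \pi_Q (c%:A) * x.

Lemma quot_scaleA a b x :
  quot_scale a (quot_scale b x) = quot_scale (a * b) x.
Proof.
by rewrite /quot_scale mulrA -rmorphM /= -scalerAl mul1r scalerA.
Qed.

Lemma quot_scale1 : left_id 1 quot_scale.
Proof. by move=> x; rewrite /quot_scale scale1r rmorph1 mul1r. Qed.

Lemma quot_scaleDr : right_distributive quot_scale +%R.
Proof. by move=> c x y; rewrite /quot_scale mulrDr. Qed.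

Lemma quot_scaleDl x : {morph quot_scale^~ x : a b / a + b}.
Proof. by move=> a b; rewrite /quot_scale scalerDl rmorphD /= mulrDl. Qed.

HB.instance Definition _ := GRing.Zmodule_isLmodule.Build K Q
  quot_scaleA quot_scale1 quot_scaleDr quot_scaleDl.

Lemma quot_scaleAl (c : K) (x y : Q) : c *: (x * y) = (c *: x) * y.
Proof. exact: mulrA. Qed.

HB.instance Definition _ := GRing.Lmodule_isLalgebra.Build K Q quot_scaleAl.
HB.instance Definition _ := GRing.Lalgebra_isComAlgebra.Build K Q.

Lemma quot_pi_scale (c : K) (p : B) : \pi_Q (c *: p) = c *: \pi_Q p.
Proof.
by rewrite -[in LHS](mul1r p) scalerAl rmorphM.
Qed.

End QuotientAlgebra.

Section GeneratedIdeal.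
Variables (B : comNzRingType) (k : nat) (g : 'I_k -> B).

Definition gen_ideal : {pred B} :=
  [pred p | `[< exists c : 'I_k -> B, p = \sum_i c i * g i >]].

Lemma gen_idealP p :
  reflect (exists c : 'I_k -> B, p = \sum_i c i * g i) (p \in gen_ideal).
Proof. exact: asboolP. Qed.

Lemma gen_ideal_closed : 1 \notin gen_ideal -> idealr_closed gen_ideal.
Proof.
move=> N1; split=> // [|a x y /gen_idealP[c ->] /gen_idealP[d ->]].
  apply/gen_idealP; exists (fun=> 0).
  by rewrite big1 // => i _; rewrite mul0r.
apply/gen_idealP; exists (fun i => a * c i + d i).
by rewrite mulr_sumr -big_split; apply: eq_bigr => i _; rewrite mulrDl mulrA.
Qed.

End GeneratedIdeal.

Section AffineAlgebra.
Variables (K : closedFieldType) (R : comAlgType K).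

Definition derivation (D : R -> R) : Prop :=
  linear D /\ (forall f g, D (f * g) = D f * g + f * D g).

Definition locally_nilpotent (D : R -> R) : Prop :=
  forall f, exists k, iter k D f = 0.

Definition rigid : Prop :=
  forall D : R -> R, derivation D -> locally_nilpotent D -> forall f, D f = 0.

(* The K-points of Spec R. For R of finite type these are its closed points. *)
Definition point : Type := {lrmorphism R -> K^o}.

(* The automorphisms of Spec R are the K-algebra automorphisms of R, acting
   on points by precomposition. *)
Definition same_orbit (x y : point) : Prop :=
  exists2 phi : {lrmorphism R -> R}, bijective phi & forall f, y f = x (phi f).

Definition finitely_many_orbits : Prop :=
  exists (k : nat) (x : 'I_k -> point),
    forall y, exists i, same_orbit (x i) y.

End AffineAlgebra.

Section Trinomial.
Variable K : closedFieldType.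

(* The integer r >= 1 is k.+1 throughout, so that both index sets I have k
   elements. The blocks 1, ..., r of type 1 are numbered from 0 here. *)
Variant trinomial_matrix (k : nat) : Type :=
| Type1 (a : 'I_k.+1 -> K) of injective a
| Type2 (a : 'M[K]_(2, k.+2)) of
    (forall i j, i != j -> free [:: col i a; col j a]).

Definition nblocks k (A : trinomial_matrix k) : nat :=
  match A with Type1 _ _ => k.+1 | Type2 _ _ => k.+2 end.

Record trinomial_data : Type := TrinomialData {
  tri_k : nat;
  tri_A : trinomial_matrix tri_k;
  tri_n : 'I_(nblocks tri_A) -> nat;
  tri_n_gt0 : forall i, (0 < tri_n i)%N;
  tri_l : forall i, 'I_(tri_n i) -> nat;
  tri_l_gt0 : forall i j, (0 < @tri_l i j)%N
}.

(* Every argument of inord below is smaller than the size of the target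
   ordinal type, so inord never falls back to its default value. *)
Definition trinomial_relation (P : comAlgType K) k (A : trinomial_matrix k) :
    ('I_(nblocks A) -> P) -> 'I_k -> P :=
  match A return ('I_(nblocks A) -> P) -> 'I_k -> P with
  | Type1 a _ => fun T i =>
      T (inord i) - T (inord i.+1) - (a (inord i.+1) - a (inord i))%:A
  | Type2 a _ => fun T i =>
      \det (col_mx (\row_(v < 3) T (inord (i + v)))
                   (\matrix_(u < 2, v < 3) (a u (inord (i + v)))%:A))
  end.

Lemma trinomial_relation_zero k (A : trinomial_matrix k) N :
  exists c : 'I_(nblocks A) -> K,
  forall (T : 'I_(nblocks A) -> {mpoly K[N]}) (x : 'I_N -> K),
    (forall i, (T i).@[x] = c i) ->
    forall i, (trinomial_relation T i).@[x] = 0.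
Proof.
have ev (x : 'I_N -> K) (c : K) : (c%:A : {mpoly K[N]}).@[x] = c.
  by rewrite mevalZ meval1 mulr1.
case: A => a ha.
  exists (fun i => - a i) => T x hx i /=.
  by rewrite !mevalB !hx ev; ring.
exists (fun=> 0) => T x hx i /=.
rewrite -det_map_mx (expand_det_row _ (lshift 2 0)) big1 // => j _.
by rewrite mxE col_mxEu mxE /= hx mul0r.
Qed.

Variables (A : trinomial_data) (m : nat).

Definition nvars : nat := (\sum_i tri_n (t := A) i + m)%N.

(* The variable T_ij; the variables S_k are the 'X_(rshift _ k), k < m. *)
Definition varT i (j : 'I_(tri_n (t := A) i)) : {mpoly K[nvars]} :=
  'X_(lshift m (tagnat.Rank i j)).

Definition monT (i : 'I_(nblocks (tri_A A))) : {mpoly K[nvars]} :=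
  \prod_(j < tri_n i) varT j ^+ tri_l j.

Definition trinomial : 'I_(tri_k A) -> {mpoly K[nvars]} :=
  trinomial_relation monT.

Lemma trinomial_zero :
  exists x : 'I_nvars -> K, forall i, (trinomial i).@[x] = 0.
Proof.
have root_ex (c : K) d : (0 < d)%N -> exists z, z ^+ d = c.
  move=> d0; have [z] := solve_monicpoly (fun i => if i == 0%N then c else 0) d0.
  case: d d0 => // d _; rewrite big_ord_recl /= expr0 mulr1 big1 ?addr0 => [e|i _].
    by exists z.
  by rewrite mul0r.
have solve (c : 'I_(nblocks (tri_A A)) -> K) :
    exists x : 'I_nvars -> K, forall i, (monT i).@[x] = c i.
  have [z hz] : exists z : 'I_(nblocks (tri_A A)) -> K,
      forall i, z i ^+ tri_l (Ordinal (tri_n_gt0 i)) = c i.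
    have /choice [z hz] : forall i, exists z,
        z ^+ tri_l (Ordinal (tri_n_gt0 i)) = c i.
      by move=> i; apply: root_ex; apply: tri_l_gt0.
    by exists z.
  pose x (u : 'I_nvars) : K := match split u with
    | inl v => if tagnat.sig2 v == 0%N :> nat then z (tagnat.sig1 v) else 1
    | inr _ => 0 end.
  exists x => i; rewrite /monT rmorph_prod /= (bigD1 (Ordinal (tri_n_gt0 i))) //=.
  have xE j : x (lshift m (tagnat.Rank i j)) =
      if j == 0%N :> nat then z i else 1.
    rewrite /x (unsplitK (inl _)) /= tagnat.Rank2K /= .
    by rewrite tagnat.Rank1K.
  rewrite big1 ?mulr1 => [|j jN0].
    by rewrite rmorphXn /= mevalXU xE /= hz.
  rewrite rmorphXn /= mevalXU xE ifN ?expr1n //.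
have [c hc] := trinomial_relation_zero (tri_A A) nvars.
by have [x hx] := solve c; exists x; apply: hc.
Qed.

Lemma trinomial_ideal_proper : 1 \notin gen_ideal trinomial.
Proof.
have [x hx] := trinomial_zero; apply/gen_idealP => -[c].
move=> /(congr1 (meval x)); rewrite meval1 rmorph_sum /= big1 => [/eqP|i _].
  by rewrite oner_eq0.
by rewrite mevalM hx mulr0.
Qed.

Definition trinomial_ideal : {pred {mpoly K[nvars]}} := gen_ideal trinomial.

HB.instance Definition _ := isIdealr.Build _ trinomial_ideal
  (gen_ideal_closed trinomial_ideal_proper).

Definition trinomial_algebra : comAlgType K := {ideal_quot trinomial_ideal}.

Local Notation piR := (\pi_({ideal_quot trinomial_ideal})).

Lemma trinomial_point_of_zero (x : 'I_nvars -> K) :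
  (forall i, (trinomial i).@[x] = 0) ->
  exists p : point trinomial_algebra,
    forall f : {mpoly K[nvars]}, p (piR f) = f.@[x].
Proof.
move=> hx; pose ev (f : trinomial_algebra) : K^o := (repr f).@[x].
have evE f : ev (piR f) = f.@[x].
  apply/eqP; rewrite -subr_eq0 -mevalB.
  have : repr (piR f) - f \in trinomial_ideal by rewrite Quotient.idealrBE reprK.
  move=> /gen_idealP[c ->]; rewrite rmorph_sum /= big1 // => i _.
  by rewrite mevalM hx mulr0.
have ev_lin : linear ev.
  move=> c f g; rewrite -[f]reprK -[g]reprK -quot_pi_scale -rmorphD !evE.
  by rewrite mevalD mevalZ.
have ev_mul : monoid_morphism ev.
  split=> [|f g]; first by rewrite -(rmorph1 piR) evE meval1.
  by rewrite -[f]reprK -[g]reprK -rmorphM !evE mevalM.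
pose evL := GRing.isLinear.Build K trinomial_algebra K^o _ ev ev_lin.
pose evM := GRing.isMonoidMorphism.Build trinomial_algebra K^o ev ev_mul.
pose p : point trinomial_algebra := HB.pack ev evL evM.
by exists p.
Qed.

Lemma trinomial_zero_of_point (p : point trinomial_algebra) :
  let x u := p (piR 'X_u) in
  (forall f : {mpoly K[nvars]}, p (piR f) = f.@[x]) /\
  (forall i, (trinomial i).@[x] = 0).
Proof.
move=> x; have pE (f : {mpoly K[nvars]}) : p (piR f) = f.@[x].
  rewrite [f in LHS]mpolyE [f in RHS]mpolyE !rmorph_sum /=.
  apply: eq_bigr => t _; rewrite quot_pi_scale linearZ /= mevalZ; congr (_ * _).
  rewrite mpolyXE_id !rmorph_prod /=; apply: eq_bigr => u _.
  by rewrite !rmorphXn /= mevalXU.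
split=> // i; rewrite -pE -(rmorph0 p) -(rmorph0 piR); congr (p _).
apply/eqP; rewrite -Quotient.idealrBE subr0.
apply/gen_idealP; exists (fun j => (j == i)%:R).
rewrite (bigD1 i) //= eqxx mul1r big1 ?addr0 // => j /negPf ->.
by rewrite mul0r.
Qed.

End Trinomial.

(* Main.v *)
(** A nonzero LND [D] of [K[Y(A)]] moves the points of [Y(A)] across the general
    orbits of the torus, whose complexity is one.  The block monomials
    [T_i^{l_i}] are linear forms [al_i U + be_i V] in two functions, with [V = 1]
    for type 1.  The torus and the translations of the [S_k] act transitively on
    the points with given zero pattern and given ratio [U : V], so points with
    some [T_ij = 0] form finitely many orbits.  On the others, [D] changes the
    ratio [U : V]: otherwise [V * D U = U * D V], and as [K[Y(A)]] is free over
    [K[U, V]] (a basis is given by the monomials divisible by no [T_i^{l_i}]),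
    [U] divides [D U], whence [D U = 0] and finally [D = 0].  So along some orbit
    of [exp(t D)] the ratio is a nonconstant rational function of [t], which
    takes all but finitely many values. *)

From HB Require Import structures.
Require Import Defs.
From mathcomp Require Import all_boot all_order all_algebra.
From mathcomp Require Import boolp ring.
From mathcomp Require Import cyclotomic separable.
From mathcomp Require Import mpoly.

Set Implicit Arguments.
Unset Strict Implicit.
Unset Printing Implicit Defensive.

Import GRing.Theory.
Local Open Scope ring_scope.
Local Open Scope quotient_scope.

(** * Reduced monomials *)

(** The obstacle is that the quotient by the trinomial relations is not known beforehand to be
    reduced, nor to be free on the reduced monomials. Both facts are read off its K-points. Over a
    fixed [(u, v)] with nonzero block values, the points with nonzero coordinates form a coset of
    the group of all [t] on which every block monomial is 1. Reduced monomials restrict to distinct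
    characters of that group, so Dedekind's lemma makes them independent on each fibre. Hence a
    function vanishing at all points is zero, and afterwards morphisms, exponentials and
    automorphisms are given by formulas whose laws are checked at points. The coordinates [U], [V]
    are normalised so that no [be i] vanishes. Then all block values are nonzero over [U = 0],
    [V != 0], so divisibility by [U] can be tested on points with nonzero coordinates; and where a
    block monomial vanishes, [U] determines [V]. Working with [D] on [Y(A)], where every variable
    lies in a block, matters too: a generator that divides a constant block monomial along a curve
    is itself constant there. *)

Section ClosedField.
Variable K : closedFieldType.

Lemma exists_nth_root (c : K) d : (0 < d)%N -> exists z, z ^+ d = c.
Proof.
move=> d0; have /closed_rootP[z] : size ('X^d - c%:P) != 1.
  by rewrite size_XnsubC // eqSS -lt0n.
by rewrite rootE !hornerE subr_eq0 => /eqP; exists z.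
Qed.

Lemma exists_pow_neq a b : a != b -> exists2 z : K, z != 0 & z ^+ a != z ^+ b.
Proof.
move=> ab; have /closed_nonrootP[z] : 'X * ('X^a - 'X^b) != 0 :> {poly K}.
  rewrite mulf_neq0 ?polyX_eq0 // subr_eq0; apply: contra ab => /eqP e.
  by have := congr1 (size \o val) e; rewrite /= !size_polyXn => -[->].
rewrite rootE !hornerE mulf_eq0 subr_eq0 negb_or => /andP[z0 zab].
by exists z.
Qed.

(** ['X^l - 1] is separable, so it has [l] distinct roots. If all of them satisfied [z ^+ d = 1],
    they would be roots of ['X^(d %% l) - 1], which is nonzero of smaller degree. *)
Lemma exists_unity_root_neq (charK : [pchar K] =i pred0) l d :
  (0 < l)%N -> ~~ (l %| d)%N -> exists2 z : K, z ^+ l = 1 & z ^+ d != 1.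
Proof.
move=> l0 ld.
have [s Ds] := closed_field_poly_normal ('X^l - 1 : {poly K}).
have m1 : ('X^l - 1 : {poly K}) \is monic.
  by rewrite -[1]/(1%:P) monicXnsubC.
rewrite (monicP m1) scale1r in Ds.
have us : uniq s.
  rewrite -separable_prod_XsubC -Ds separable_Xn_sub_1 //.
  by rewrite ((pcharf0P K).1 charK) -lt0n.
have ss : size s = l.
  have := congr1 (size \o val) Ds; rewrite /= size_prod_XsubC.
  by rewrite -[1]/(1%:P) size_XnsubC // => -[].
have sr z : z \in s -> z ^+ l = 1.
  move=> zs; have : root (\prod_(z <- s) ('X - z%:P)) z by rewrite root_prod_XsubC.
  by rewrite -Ds rootE !hornerE subr_eq0 => /eqP.
have d0 : (0 < d %% l)%N by rewrite lt0n.
have [/allP sd|] := boolP (all (fun z => z ^+ d == 1) s); last first.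
  by case/allPn => z zs zd; exists z; [exact: sr|].
have : (size s < size ('X^(d %% l) - 1 : {poly K})%R)%N.
  apply: max_poly_roots => //.
    by rewrite -size_poly_eq0 -[1]/(1%:P) size_XnsubC.
  apply/allP => z zs; rewrite rootE !hornerE subr_eq0.
  have := sd _ zs; rewrite {1}(divn_eq d l) exprD mulnC exprM sr // expr1n.
  by rewrite mul1r.
by rewrite -[1]/(1%:P) size_XnsubC // ss ltnS leqNgt ltn_mod l0.
Qed.

End ClosedField.

Section BlockMonomials.
Variables (K : closedFieldType) (charK : [pchar K] =i pred0).
Variables (I : finType) (N : nat) (blk : 'I_N -> option I) (l : 'I_N -> nat).
Hypothesis l_gt0 : forall k, (0 < l k)%N.
Hypothesis blk_surj : forall i, exists k, blk k = Some i.

Definition block_mon (i : I) : 'X_{1..N} :=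
  [multinom ((blk k == Some i) * l k)%N | k < N].

Definition reduced (mu : 'X_{1..N}) : Prop :=
  forall i, exists2 k, blk k = Some i & (mu k < l k)%N.

Lemma mmap1_at (k0 : 'I_N) (a : K) (mu : 'X_{1..N}) :
  mmap1 (fun k => if k == k0 then a else 1) mu = a ^+ mu k0.
Proof.
rewrite /mmap1 (bigD1 k0) //= eqxx big1 ?mulr1 // => k /negPf ->.
by rewrite expr1n.
Qed.

Lemma mmap1M (x y : 'I_N -> K) (mu : 'X_{1..N}) :
  mmap1 (fun k => x k * y k) mu = mmap1 x mu * mmap1 y mu.
Proof. by rewrite -big_split; apply: eq_bigr => k _; rewrite exprMn. Qed.

Lemma mmap1_neq0 (x : 'I_N -> K) (mu : 'X_{1..N}) :
  (forall k, x k != 0) -> mmap1 x mu != 0.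
Proof. by move=> x0; apply/prodf_neq0 => k _; rewrite expf_neq0. Qed.

(* Distinct reduced monomials are congruent modulo no combination of the block
   monomials, hence restrict to distinct characters of the group of all [t]
   on which the block monomials are [1]. *)
Lemma separate_reduced (mu nu : 'X_{1..N}) :
  reduced mu -> reduced nu -> mu != nu ->
  exists t : 'I_N -> K, [/\ forall k, t k != 0,
    forall i, mmap1 t (block_mon i) = 1 & mmap1 t mu != mmap1 t nu].
Proof.
move=> rmu rnu neq.
have [k0 nk0] : exists k, mu k != nu k.
  apply: contrapT => h; case/negP: neq; apply/eqP/mnmP => k.
  by apply/eqP/negPn/negP => hk; apply: h; exists k.
wlog lt0 : mu nu rmu rnu neq nk0 / (nu k0 < mu k0)%N.
  move=> W; have [/W|] := ltnP (nu k0) (mu k0); first exact.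
  rewrite leq_eqVlt (negPf nk0) /= => /(W nu mu); rewrite eq_sym in neq.
  rewrite eq_sym in nk0; case=> // t [t0 t1 tn].
  by exists t; split=> //; rewrite eq_sym.
case bk0 : (blk k0) => [i0|]; last first.
  have [z z0 zn] := exists_pow_neq K nk0.
  exists (fun k => if k == k0 then z else 1); split=> [k|i|].
  - by case: ifP => // _; apply: oner_neq0.
  - by rewrite mmap1_at mnmE bk0 mul0n.
  - by rewrite !mmap1_at.
(* If [mu - nu] is not proportional to [l] on the block of [k0], the one-parameter group with weight
   [l k1] at [k0] and [- l k0] at [k1] fixes all block monomials and separates [mu] from [nu]. *)
have [[k1 [bk1 n1]]|h1] := pselect (exists k1, blk k1 = Some i0 /\
  (l k1 * mu k0 + l k0 * nu k1 != l k1 * nu k0 + l k0 * mu k1)%N).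
  have [z z0 zn] := exists_pow_neq K n1.
  pose t k := (if k == k0 then z ^+ l k1 else 1) *
              (if k == k1 then z ^- l k0 else 1).
  have tE e : mmap1 t e = z ^+ (l k1 * e k0) / z ^+ (l k0 * e k1).
    by rewrite mmap1M !mmap1_at -exprM exprVn -exprM.
  exists t; split=> [k|i|].
  - by rewrite /t mulf_neq0 //; case: ifP => // _;
      rewrite ?oner_neq0 ?invr_eq0 ?expf_neq0.
  - rewrite tE !mnmE bk0 bk1; case: eqP => _; last by rewrite !mul0n !muln0 divr1.
    by rewrite !mul1n mulnC divff // expf_neq0.
  - apply: contra zn; rewrite !tE eqr_div ?expf_neq0 //.
    by rewrite -!exprD.
(* Now [mu - nu] is a positive multiple of [l] on the block. An integral factor would be at least 1
   and give [l k <= mu k] on the whole block, against reducedness of [mu]. So a root of unity placed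
   at [k0] alone separates. *)
have ld : ~~ (l k0 %| mu k0 - nu k0)%N.
  apply/negP => /dvdn_leq; rewrite subn_gt0 => /(_ lt0) le0.
  have [k1 bk1 lt1] := rmu i0; apply: h1; exists k1; split=> //.
  have : (l k1 * nu k0 + l k0 * mu k1 < l k1 * mu k0 + l k0 * nu k1)%N.
    rewrite -(subnKC (ltnW lt0)) mulnDr -addnA ltn_add2l.
    apply: leq_trans (leq_addr _ _); apply: (@leq_trans (l k0 * l k1)).
      by rewrite ltn_pmul2l.
    by rewrite mulnC leq_mul2l le0 orbT.
  by rewrite ltn_neqAle eq_sym => /andP[].
have [z zl zd] := exists_unity_root_neq charK (l_gt0 k0) ld.
have z0 : z != 0.
  by apply: contra_eq_neq zl => ->; rewrite expr0n gtn_eqF // eq_sym oner_neq0.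
exists (fun k => if k == k0 then z else 1); split=> [k|i|].
- by case: ifP => // _; apply: oner_neq0.
- by rewrite mmap1_at mnmE; case: eqP => _; rewrite ?mul1n ?mul0n.
- rewrite !mmap1_at -(subnK (ltnW lt0)) exprD; apply: contra zd => /eqP e.
  by apply/eqP/(mulIf (expf_neq0 (nu k0) z0)); rewrite e mul1r.
Qed.

Lemma mmap1_representatives (r : I -> 'I_N) (z : I -> K) i :
  (forall i, blk (r i) = Some i) ->
  mmap1 (fun k => if blk k is Some i then if k == r i then z i else 1 else 1)
    (block_mon i) = z i ^+ l (r i).
Proof.
move=> rP; rewrite /mmap1 (bigD1 (r i)) //= rP eqxx mnmE rP eqxx mul1n.
rewrite big1 ?mulr1 // => k ki.
rewrite mnmE; case: eqP => [->|_]; last by rewrite mul0n.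
by rewrite (negPf ki) expr1n.
Qed.

Lemma eq_mmap1_block (x y : 'I_N -> K) i :
  (forall k, blk k = Some i -> x k = y k) ->
  mmap1 x (block_mon i) = mmap1 y (block_mon i).
Proof.
move=> h; apply: eq_bigr => k _; rewrite mnmE; case: eqP => [/h -> //|_].
by rewrite mul0n.
Qed.

Lemma mmap1_block_eq0 (x : 'I_N -> K) i :
  mmap1 x (block_mon i) = 0 <-> exists2 k, blk k = Some i & x k = 0.
Proof.
split=> [/eqP /prodf_eq0[k _]|[k bk xk]].
  rewrite expf_eq0 mnmE; case: eqP => [bk|_]; last by rewrite mul0n.
  by case/andP => _ /eqP; exists k.
apply/eqP/prodf_eq0; exists k => //; rewrite mnmE bk eqxx mul1n xk expr0n.
by rewrite gtn_eqF.
Qed.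

Lemma exists_fibre_point (y : I -> K) : (forall i, y i != 0) ->
  exists x : 'I_N -> K, [/\ forall k, x k != 0 &
    forall i, mmap1 x (block_mon i) = y i].
Proof.
move=> y0; have [r rP] := choice blk_surj.
have /choice[z zP] : forall i, exists z, z ^+ l (r i) = y i.
  by move=> i; apply: exists_nth_root.
exists (fun k => if blk k is Some i then if k == r i then z i else 1 else 1).
split=> [k|i].
  case: (blk k) => [i|]; last exact: oner_neq0.
  case: ifP => _; last exact: oner_neq0.
  by apply: contraNneq (y0 i) => zi; rewrite -zP zi expr0n gtn_eqF.
by rewrite mmap1_representatives.
Qed.

(* Dedekind's independence of characters. *)
Lemma reduced_independent (y : I -> K) (s : seq 'X_{1..N}) (c : 'X_{1..N} -> K) :
  (forall i, y i != 0) -> uniq s -> (forall mu, mu \in s -> reduced mu) ->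
  (forall x : 'I_N -> K, (forall k, x k != 0) ->
     (forall i, mmap1 x (block_mon i) = y i) ->
     \sum_(mu <- s) c mu * mmap1 x mu = 0) ->
  forall mu, mu \in s -> c mu = 0.
Proof.
move=> y0; elim: s c => // nu s IH c /= /andP[nus us] rs h.
have cs mu : mu \in s -> c mu = 0.
  move=> mus.
  have [t [t0 t1 tn]] := separate_reduced (rs mu (mem_behead (s := nu :: s) mus))
    (rs nu (mem_head _ _)) (contraNneq (fun e => eq_ind mu (in_mem^~ _) mus nu e) nus).
  (* The point [t * x] lies in the same fibre as [x]. The relation at [t * x] minus [mmap1 t nu]
     times the relation at [x] has no [nu] term, so the induction hypothesis applies. *)
  apply/eqP; have : c mu * (mmap1 t mu - mmap1 t nu) = 0.
    apply: (IH (fun mu => c mu * (mmap1 t mu - mmap1 t nu))) => // [k ks|x x0 xy].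
      by apply: rs; rewrite inE ks orbT.
    have h1 := h x x0 xy.
    have h2 : \sum_(mu <- nu :: s) c mu * mmap1 (fun k => t k * x k) mu = 0.
      apply: h => [k|i]; first exact: mulf_neq0.
      by rewrite mmap1M t1 mul1r.
    rewrite !big_cons in h1 h2.
    move: h2; under eq_bigr do rewrite mmap1M; rewrite mmap1M => h2.
    transitivity (\sum_(mu <- s) c mu * (mmap1 t mu * mmap1 x mu) -
                  mmap1 t nu * \sum_(mu <- s) c mu * mmap1 x mu).
      by rewrite mulr_sumr -sumrB; apply: eq_bigr => k _; ring.
    have -> : \sum_(mu <- s) c mu * mmap1 x mu = - (c nu * mmap1 x nu).
      by apply/eqP; rewrite -addr_eq0 addrC h1.
    by rewrite mulrN opprK addrC mulrCA.
  by move/eqP; rewrite mulf_eq0 subr_eq0 (negPf tn) orbF.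
move=> mu; rewrite inE => /orP[/eqP->|/cs //].
have [x [x0 xy]] := exists_fibre_point y0.
have := h x x0 xy; rewrite big_cons big_seq big1 ?addr0 => [/eqP|k ks].
  by rewrite mulf_eq0 (negPf (mmap1_neq0 _ x0)) orbF => /eqP.
by rewrite cs // mul0r.
Qed.

(** Divide by block monomials as long as one of them divides. Each has positive degree because its
    block is nonempty, so the degree drops. *)
Lemma exists_reduction (a : 'X_{1..N}) :
  exists p : 'X_{1..N} * {ffun I -> nat},
    reduced p.1 /\ a = (p.1 + \sum_i block_mon i *+ p.2 i)%MM.
Proof.
have [d] := ubnP (mdeg a); elim: d a => // d IH a; rewrite ltnS => ad.
have [ra|nra] := pselect (reduced a).
  exists (a, [ffun=> 0%N]); split=> //=.
  by rewrite big1 ?addm0 // => i _; rewrite ffunE mulm0n.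
have [i hi] : exists i, forall k, blk k = Some i -> (l k <= a k)%N.
  apply: contrapT => h; apply: nra => i; apply: contrapT => h1.
  apply: h; exists i => k bk; rewrite leqNgt; apply/negP => lt.
  by apply: h1; exists k.
have le : (block_mon i <= a)%MM.
  apply/mnm_lepP => k; rewrite mnmE; case: eqP => [/hi|_]; rewrite ?mul1n //.
have [|[mu f] /= [rmu e]] := IH (a - block_mon i)%MM.
  have [k bk] := blk_surj i; rewrite -(submK le) mdegD in ad.
  apply: leq_trans ad; rewrite -addn1 leq_add2l mdegE (bigD1 k) //= mnmE bk eqxx mul1n.
  exact: leq_trans (l_gt0 k) (leq_addr _ _).
exists (mu, [ffun j => ((j == i) + f j)%N]); split=> //=.
rewrite -(submK le) e -addmA; congr (_ + _)%MM.
rewrite (bigD1 i) //= [RHS](bigD1 i) //= ffunE eqxx add1n mulmS.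
rewrite addmC -addmA; congr (_ + (_ + _))%MM; apply: eq_bigr => j /negPf ji.
by rewrite ffunE ji.
Qed.

End BlockMonomials.

(** * Exponentials of locally nilpotent derivations *)

Section RationalCurve.
Variable K : closedFieldType.

(* A nonconstant morphism from the line to the projective line misses at most
   one point; the other exceptional ratios come from common zeros of [u] and
   [v]. *)
Lemma ratio_cofinite (u v : {poly K}) : u^`() * v != u * v^`() ->
  exists E : seq K, forall z, z \notin E ->
    exists2 t, v.[t] != 0 & u.[t] = z * v.[t].
Proof.
move=> wr; pose g := gcdp u v; pose u1 := u %/ g; pose v1 := v %/ g.
have v0 : v != 0 by apply: contraNneq wr => ->; rewrite deriv0 !mulr0.
have g0 : g != 0 by rewrite gcdp_eq0 negb_and v0 orbT.
have Du : u = u1 * g by rewrite divpK ?dvdp_gcdl.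
have Dv : v = v1 * g by rewrite divpK ?dvdp_gcdr.
have cop : coprimep u1 v1 by rewrite coprimep_div_gcd // v0 orbT.
pose d := (maxn (size u1) (size v1)).-1.
have d1 : (0 < d)%N.
  rewrite lt0n; apply: contraNneq wr => d0.
  have /andP[/size1_polyC ua /size1_polyC vb] :
      (size u1 <= 1)%N && (size v1 <= 1)%N.
    by rewrite -geq_max; move: d0; rewrite /d; case: maxn => // -[].
  by apply/eqP; rewrite Du Dv ua vb !derivM !derivC; ring.
have md : maxn (size u1) (size v1) = d.+1.
  by rewrite prednK // (leq_trans _ (leq_pred _)).
have nd : (u1`_d != 0) || (v1`_d != 0).
  move: md; rewrite /maxn; case: ifP => _ sd; apply/orP; [right|left].
    by rewrite -[d]/(d.+1.-1) -sd -lead_coefE lead_coef_eq0 -size_poly_gt0 sd.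
  by rewrite -[d]/(d.+1.-1) -sd -lead_coefE lead_coef_eq0 -size_poly_gt0 sd.
have [s Ds] := closed_field_poly_normal g.
(* Excluded are the value at infinity, where [u1 - z *: v1] loses its coefficient of degree [d]
   (read as 0 when the denominator is 0), and the ratios at the roots of [g], where [v] vanishes. *)
exists (u1`_d / v1`_d :: [seq u1.[t] / v1.[t] | t <- s]) => z.
rewrite inE negb_or => /andP[zd zs].
have pd : (u1 - z *: v1)`_d != 0.
  rewrite coefB coefZ subr_eq0; have [vd|vd] := eqVneq v1`_d 0.
    by rewrite vd mulr0; move: nd; rewrite vd eqxx orbF.
  by apply: contra zd => /eqP ->; rewrite mulfK.
have /closed_rootP[t] : size (u1 - z *: v1) != 1.
  rewrite gtn_eqF // (leq_trans (_ : 1 < d.+1)%N) // ltnNge.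
  by apply: contra pd => h; rewrite nth_default.
rewrite rootE !hornerE subr_eq0 => /eqP ut.
have vt : v1.[t] != 0.
  apply/eqP => vt0; have := coprimep_root cop (_ : root u1 t).
  by rewrite rootE ut vt0 mulr0 !eqxx => /(_ isT).
exists t; last by rewrite Du Dv !hornerM ut mulrA.
rewrite Dv hornerM mulf_neq0 //; apply: contra zs => gt.
apply/mapP; exists t; last by rewrite ut mulfK.
have : root g t by [].
by rewrite Ds rootZ ?lead_coef_eq0 // root_prod_XsubC.
Qed.

End RationalCurve.

Section Exponential.
Variables (K : closedFieldType) (charK : [pchar K] =i pred0).
Variables (R : comAlgType K) (D : R -> R).
Hypotheses (derD : derivation D) (lnD : locally_nilpotent D).

Lemma derivationP c f g : D (c *: f + g) = c *: D f + D g.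
Proof. by case: derD => lin _; apply: lin. Qed.

Lemma derivation0 : D 0 = 0.
Proof. by have := derivationP (-1) 0 0; rewrite scaler0 addr0 scaleN1r addNr. Qed.

Lemma derivationD f g : D (f + g) = D f + D g.
Proof. by rewrite -[f]scale1r derivationP !scale1r. Qed.

Lemma derivationZ c f : D (c *: f) = c *: D f.
Proof. by rewrite -[c *: f]addr0 derivationP derivation0 addr0. Qed.

Lemma derivationM f g : D (f * g) = D f * g + f * D g.
Proof. by case: derD => _; apply. Qed.

Lemma derivation1 : D 1 = 0.
Proof.
have := derivationM 1 1; rewrite !mul1r !mulr1 => /eqP.
by rewrite -subr_eq0 opprD addNKr oppr_eq0 => /eqP.
Qed.

Lemma derivation_sum (J : Type) (s : seq J) (P : pred J) F :
  D (\sum_(j <- s | P j) F j) = \sum_(j <- s | P j) D (F j).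
Proof. exact: (big_morph D derivationD derivation0). Qed.

Lemma iter_derivation0 i : iter i D 0 = 0.
Proof. by elim: i => //= i ->; rewrite derivation0. Qed.

Lemma iter_derivationP i c f g :
  iter i D (c *: f + g) = c *: iter i D f + iter i D g.
Proof. by elim: i => //= i ->; rewrite derivationP. Qed.

Lemma iter_derivationM n f g : iter n D (f * g) =
  \sum_(i < n.+1) (iter i D f * iter (n - i) D g) *+ 'C(n, i).
Proof.
elim: n => [|n IH] /=; first by rewrite big_ord1 bin0 mulr1n.
pose a i j := iter i D f * iter j D g.
rewrite IH derivation_sum.
transitivity (\sum_(i < n.+1) (a i.+1 (n - i)%N *+ 'C(n, i)) +
              \sum_(i < n.+1) (a i (n.+1 - i)%N *+ 'C(n, i))).
  rewrite -big_split; apply: eq_bigr => i _ /=.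
  by rewrite -scaler_nat derivationZ derivationM scaler_nat mulrnDl subSn // -ltnS.
rewrite [RHS]big_ord_recl [X in _ + X = _]big_ord_recl /= !bin0 addrCA; congr (_ + _).
rewrite [X in _ = X]big_ord_recr [X in X + _ = _]big_ord_recr /=.
rewrite [RHS](_ : _ = \sum_(i < n) a i.+1 (n - i)%N *+ 'C(n.+1, i.+1) + a n.+1 0%N);
  last by rewrite /bump /= !add1n binn subnn mulr1n; congr (_ + _).
rewrite subnn binn mulr1n addrAC -big_split; congr (_ + _).
by apply: eq_bigr => i _; rewrite /= /bump /= add1n subSS binS mulrnDr addrC.
Qed.

Let order f := projT1 (cid (lnD f)).

Lemma iter_order f i : (order f <= i)%N -> iter i D f = 0.
Proof.
move=> /subnK <-; rewrite iterD /order; case: cid => k /= ->.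
exact: iter_derivation0.
Qed.

(* The function [f] along the orbit [t |-> exp(t D)] of the point [p]. *)
Definition curve (p : point R) (f : R) : {poly K} :=
  \poly_(i < order f) ((p (iter i D f) : K) / i`!%:R).

(** [order f] is only some chosen bound, but beyond it both sides vanish. The coefficients are thus
    independent of the choice, and the laws of [curve] can be proved coefficientwise. *)
Lemma coef_curve p f i : (curve p f)`_i = (p (iter i D f) : K) / i`!%:R.
Proof.
rewrite coef_poly; case: ltnP => // /iter_order ->.
by rewrite rmorph0 mul0r.
Qed.

Lemma fact_neq0 i : i`!%:R != 0 :> K.
Proof. by rewrite ((pcharf0P K).1 charK) -lt0n fact_gt0. Qed.

Lemma curveP p c f g : curve p (c *: f + g) = c *: curve p f + curve p g.
Proof.
apply/polyP => i; rewrite coefD coefZ !coef_curve iter_derivationP linearP.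
by rewrite mulrDl mulrA.
Qed.

Lemma curve0 p : curve p 0 = 0.
Proof.
by apply/polyP => i; rewrite coef_curve iter_derivation0 rmorph0 mul0r coef0.
Qed.

Lemma curveZ p c f : curve p (c *: f) = c *: curve p f.
Proof. by rewrite -[c *: f]addr0 curveP curve0 addr0. Qed.

Lemma curve1 p : curve p 1 = 1.
Proof.
apply/polyP => -[|i]; rewrite coef_curve coef1 /=.
  by rewrite rmorph1 divr1.
by rewrite -iterS iterSr derivation1 iter_derivation0 rmorph0 mul0r.
Qed.

Lemma curveM p f g : curve p (f * g) = curve p f * curve p g.
Proof.
apply/polyP => n; rewrite coefM coef_curve iter_derivationM rmorph_sum mulr_suml.
apply: eq_bigr => i _; rewrite !coef_curve rmorphMn rmorphM /=.
rewrite -(bin_fact (ltn_ord i : i <= n)%N).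
rewrite !natrM -mulr_natr; have := fact_neq0 i; have := fact_neq0 (n - i).
have : 'C(n, i)%:R != 0 :> K by rewrite ((pcharf0P K).1 charK) -lt0n bin_gt0 -ltnS.
move=> c0 h1 h2; field; by rewrite c0 h1 h2.
Qed.

Lemma curve_prod p (J : Type) (s : seq J) (P : pred J) F :
  curve p (\prod_(j <- s | P j) F j) = \prod_(j <- s | P j) curve p (F j).
Proof. exact: (big_morph _ (curveM p) (curve1 p)). Qed.

Lemma curveX p f n : curve p (f ^+ n) = curve p f ^+ n.
Proof. by elim: n => [|n IH]; rewrite ?curve1 // !exprS curveM IH. Qed.

Lemma curve_deriv p f : (curve p f)^`() = curve p (D f).
Proof.
apply/polyP => i; rewrite coef_deriv -mulr_natr !coef_curve -iterSr factS natrM.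
have := fact_neq0 i; have : i.+1%:R != 0 :> K by rewrite ((pcharf0P K).1 charK).
move: (i.+1%:R) (i`!%:R) (p _ : K) => x y a hx hy.
by field; rewrite hx hy.
Qed.

Lemma curve_at0 p f : (curve p f).[0] = p f.
Proof. by rewrite horner_coef0 coef_curve /= divr1. Qed.

Hypothesis points_separate : forall f : R, (forall p : point R, p f = 0) -> f = 0.

(** The map is the finite sum [exp(c D)]. Its composite with each point is multiplicative because
    [curve p] is, and separation by points carries this back to [R]. *)
Lemma exp_exists c : exists E : {lrmorphism R -> R},
  forall (p : point R) f, p (E f) = (curve p f).[c].
Proof.
pose E f : R := \sum_(i < order f) (c ^+ i / i`!%:R) *: iter i D f.
have pE (p : point R) f : p (E f) = (curve p f).[c].
  rewrite /curve horner_poly rmorph_sum; apply: eq_bigr => i _ /=.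
  rewrite linearZ /= -[LHS]/(_ * _) mulrC -mulrA; congr (_ * _).
  exact: mulrC.
have eqP f g : (forall p : point R, p f = p g) -> f = g.
  move=> h; apply/eqP; rewrite -subr_eq0; apply/eqP/points_separate => p.
  by rewrite rmorphB /= h subrr.
have E_lin : linear E.
  move=> a f g; apply: eqP => p.
  by rewrite linearP /= !pE curveP hornerD hornerZ.
have E_mul : monoid_morphism E.
  split=> [|f g]; apply: eqP => p; first by rewrite pE curve1 hornerC rmorph1.
  by rewrite rmorphM /= !pE curveM hornerM.
pose EL := GRing.isLinear.Build K R R _ E E_lin.
pose EM := GRing.isMonoidMorphism.Build R R E E_mul.
pose EE : {lrmorphism R -> R} := HB.pack E EL EM.
by exists EE.
Qed.

(** At a point [p], this is the Taylor expansion of the polynomial [curve p f] around [- c],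
    evaluated at 0: the derivatives of the curve of [f] are the curves of the [D^i f]. *)
Lemma exp_inverse c (E F : {lrmorphism R -> R}) :
  (forall (p : point R) f, p (E f) = (curve p f).[c]) ->
  (forall (p : point R) f, p (F f) = (curve p f).[- c]) ->
  cancel E F.
Proof.
move=> hE hF f; apply/eqP; rewrite -subr_eq0; apply/eqP/points_separate => p.
rewrite rmorphB; apply/eqP; rewrite subr_eq0; apply/eqP.
pose q : point R := p \o F.
rewrite -[LHS]/(q (E f)) hE -[RHS]curve_at0 -(addNr c).
rewrite (@nderiv_taylor_wide _ (order f)) ?size_poly //; last exact: mulrC.
rewrite /curve horner_poly; apply: eq_bigr => i _; congr (_ * _).
have -> : q (iter i D f) = (curve p f)^`(i).[- c].
  rewrite [LHS]hF; congr horner; elim: (i : nat) => //= j IH.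
  by rewrite -curve_deriv IH.
by rewrite nderivn_def hornerMn -mulr_natr mulfK ?fact_neq0.
Qed.

End Exponential.

(** * Algebras presented by block monomials *)

Section Points.
Variables (K : closedFieldType) (R : comAlgType K).
Implicit Type p : point R.

Lemma pointZ p (c : K) f : p (c *: f) = c * p f.
Proof. exact: linearZ. Qed.

Lemma point_scalar p (c : K) : p (c%:A) = c.
Proof. by rewrite pointZ rmorph1 mulr1. Qed.

Lemma point_mmap1 p N (g : 'I_N -> R) mu :
  p (mmap1 g mu) = mmap1 (fun k => p (g k) : K) mu.
Proof. by rewrite rmorph_prod; apply: eq_bigr => k _; rewrite rmorphXn. Qed.

Lemma point_mmap p N (g : 'I_N -> R) (P : {mpoly K[N]}) :
  p (mmap (in_alg R) g P) = P.@[fun k => p (g k)].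
Proof.
rewrite /mmap mevalE rmorph_sum; apply: eq_bigr => mu _.
by rewrite rmorphM /= point_scalar point_mmap1.
Qed.

End Points.

(* A presentation common to both types: [U] and [V] are coordinates on the
   plane (on the line [V = 1], for type 1, when [aff] holds) of the values of
   the block monomials, and blocks [None] are made of free variables. *)
Record presentation (K : closedFieldType) (I : finType) (aff : bool)
    (al be : I -> K) N (blk : 'I_N -> option I) (l : 'I_N -> nat)
    (R : comAlgType K) (g : 'I_N -> R) (U V : R) : Prop := Presentation {
  pres_gen : forall f, exists P : {mpoly K[N]}, f = mmap (in_alg R) g P;
  pres_rel : forall i,
    mmap1 g (block_mon blk l i) = al i *: U + be i *: V;
  pres_aff : aff -> V = 1;
  pres_point : forall (x : 'I_N -> K) u v, (aff -> v = 1) ->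
    (forall i, mmap1 x (block_mon blk l i) = al i * u + be i * v) ->
    exists p : point R, [/\ forall k, p (g k) = x k, p U = u & p V = v]
}.

Section Presentation.
Variables (K : closedFieldType) (charK : [pchar K] =i pred0).
Variables (I : finType) (aff : bool) (al be : I -> K).
Hypothesis be_neq0 : forall i, be i != 0.
Variables (N : nat) (blk : 'I_N -> option I) (l : 'I_N -> nat).
Hypothesis l_gt0 : forall k, (0 < l k)%N.
Hypothesis blk_surj : forall i, exists k, blk k = Some i.
Variables (R : comAlgType K) (g : 'I_N -> R) (U V : R).
Hypothesis presR : presentation aff al be blk l g U V.
Implicit Type p q : point R.

Lemma point_ext p q : (forall k, p (g k) = q (g k)) -> forall f, p f = q f.
Proof.
move=> h f; have [P ->] := pres_gen presR f.
by rewrite !point_mmap; apply: meval_eq.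
Qed.

Lemma point_block p i : mmap1 (fun k => p (g k) : K) (block_mon blk l i) =
  al i * p U + be i * p V.
Proof. by rewrite -point_mmap1 (pres_rel presR) rmorphD /= !pointZ. Qed.

Lemma point_aff p : aff -> p V = 1.
Proof. by move=> a; rewrite (pres_aff presR a) rmorph1. Qed.

(** Bivariate polynomials are nested: the outer variable goes to [U], the inner one to [V]. Writing
    the evaluation as a composite makes it a ring morphism by inference. *)
Definition eval2 : {rmorphism {poly {poly K}} -> R} :=
  horner_eval V \o (horner_eval U%:P \o map_poly (map_poly (in_alg R))).

Lemma eval2X : eval2 'X = U.
Proof.
rewrite -[LHS]/((map_poly (map_poly (in_alg R)) 'X).[U%:P].[V]).
by rewrite map_polyX hornerX hornerC.
Qed.

Lemma eval2C c : eval2 c%:P = (map_poly (in_alg R) c).[V].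
Proof.
rewrite -[LHS]/((map_poly (map_poly (in_alg R)) c%:P).[U%:P].[V]).
by rewrite map_polyC hornerC.
Qed.

Lemma point_eval2 p C : p (eval2 C) = C.[(p U)%:P].[p V].
Proof.
have e (c : {poly K}) : p (map_poly (in_alg R) c).[V] = c.[p V].
  rewrite -horner_map -map_poly_comp; congr (_.[_]).
  by apply: map_poly_id => a _; apply: point_scalar.
elim/poly_ind: C => [|C c IH]; first by rewrite rmorph0 !horner0 rmorph0.
rewrite hornerMXaddC hornerD hornerM hornerC -IH -e -eval2C -[in p U]eval2X.
by rewrite -rmorphM -rmorphD -rmorphM -rmorphD.
Qed.

Definition plane_line i : {poly {poly K}} := (al i)%:P%:P * 'X + (be i *: 'X)%:P.

Lemma eval2_line i : eval2 (plane_line i) = al i *: U + be i *: V.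
Proof.
rewrite rmorphD rmorphM eval2X !eval2C map_polyC hornerC map_polyZ map_polyX.
by rewrite hornerZ hornerX !mulr_algl.
Qed.

(** Split each monomial into a reduced one and powers of block monomials, then replace the latter by
    their linear forms in [U] and [V]; [C mu] collects the terms with reduced part [mu]. *)
Lemma normal_form f : exists (s : seq 'X_{1..N}) (C : 'X_{1..N} -> {poly {poly K}}),
  [/\ uniq s, forall mu, mu \in s -> reduced blk l mu &
      f = \sum_(mu <- s) mmap1 g mu * eval2 (C mu)].
Proof.
have [P ->] := pres_gen presR f.
have /choice[r rP] := exists_reduction l_gt0 blk_surj.
pose C mu := \sum_(a <- msupp P | (r a).1 == mu)
  (P@_a)%:P%:P * \prod_i plane_line i ^+ (r a).2 i.
exists (undup [seq (r a).1 | a <- msupp P]), C; split.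
- exact: undup_uniq.
- by move=> mu; rewrite mem_undup => /mapP[a _ ->]; case: (rP a).
have E a : mmap1 g a = mmap1 g (r a).1 * eval2 (\prod_i plane_line i ^+ (r a).2 i).
  have [_ {1}->] := rP a; rewrite commr_mmap1_M; last by move=> *; apply: mulrC.
  congr (_ * _); rewrite rmorph_prod.
  elim/big_rec2: _ => [|i x mu _ <-]; first exact: mmap11.
  rewrite commr_mmap1_M; last by move=> *; apply: mulrC.
  congr (_ * _); rewrite rmorphXn [X in _ = X ^+ _]eval2_line -(pres_rel presR).
  rewrite /mmap1 -prodrXl; apply: eq_bigr => k _.
  by rewrite mulmnE exprM.
rewrite /mmap; under [RHS]eq_bigr do rewrite /C rmorph_sum mulr_sumr.
rewrite [RHS](exchange_big_dep predT) //; apply: eq_big_seq => a aP.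
have sum1 (F : 'X_{1..N} -> R) s x : uniq s -> x \in s ->
    \sum_(mu <- s | x == mu) F mu = F x.
  move=> us xs; rewrite big_mkcond (bigD1_seq x) //= eqxx big1 ?addr0 // => mu.
  by rewrite eq_sym => /negPf ->.
rewrite sum1 ?undup_uniq //; last first.
  by rewrite mem_undup; apply: (map_f (fun a => (r a).1)).
by rewrite rmorphM eval2C map_polyC hornerC (E a) mulrCA.
Qed.

(** For fixed [v != 0], each [al i * u + be i * v] is a nonzero polynomial in [u] because
    [be i != 0]. Only finitely many [u] are excluded, so a nonzero polynomial in [u] could not
    vanish at all the others. *)
Lemma horner_at_good (C : {poly {poly K}}) v :
  (forall u, u != 0 -> (forall i, al i * u + be i * v != 0) -> C.[u%:P].[v] = 0) ->
  v != 0 -> map_poly (horner_eval v) C = 0.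
Proof.
move=> h v0; set c := map_poly _ _; apply/eqP/negPn/negP => c0.
have /closed_nonrootP[u] :
    c * ('X * \prod_i ((al i)%:P * 'X + (be i * v)%:P)) != 0.
  rewrite !mulf_neq0 ?polyX_eq0 //; apply/prodf_neq0 => i _.
  apply/eqP => /(congr1 (horner^~ 0)); rewrite !hornerE => /eqP.
  by rewrite mulf_eq0 (negPf (be_neq0 i)) (negPf v0).
rewrite rootE !hornerM hornerX horner_prod !mulf_eq0 !negb_or => /and3P[cu u0 pu].
case/negP: cu; apply/eqP; rewrite -[RHS](h u) // => [|i].
  by rewrite -[in LHS](hornerC u v) horner_map.
by move/prodf_neq0: pu => /(_ i isT); rewrite !hornerE.
Qed.

(** When [aff] holds only [v = 1] is available, and [C] itself may be nonzero; but then [V = 1], and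
    [eval2 C] depends only on [C] at inner variable 1. Otherwise every [v != 0] is available and
    [C = 0]. *)
Lemma eval2_eq0 (C : {poly {poly K}}) :
  (forall u v, (aff -> v = 1) -> u != 0 -> (forall i, al i * u + be i * v != 0) ->
     C.[u%:P].[v] = 0) -> eval2 C = 0.
Proof.
move=> h; have h1 v : (aff -> v = 1) -> v != 0 -> map_poly (horner_eval v) C = 0.
  by move=> av; apply: horner_at_good => u u0 hu; apply: h.
have [a|na] := boolP aff.
  rewrite -[LHS]/((map_poly (map_poly (in_alg R)) C).[U%:P].[V]) (pres_aff presR a).
  have -> (P : {poly {poly R}}) : P.[U%:P].[1] = (map_poly (horner_eval 1) P).[U].
    by rewrite -[in RHS](hornerC U 1) horner_map.
  rewrite (_ : map_poly _ _ = map_poly (in_alg R) (map_poly (horner_eval 1) C)).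
    by rewrite h1 ?oner_neq0 // map_poly0 horner0.
  rewrite -!map_poly_comp; apply: eq_map_poly => c /=.
  by rewrite /horner_eval -[1 in LHS](rmorph1 (in_alg R)) horner_map.
have -> : C = 0; last exact: rmorph0.
apply/polyP => k; rewrite coef0; apply/eqP/negPn/negP => ck.
have /closed_nonrootP[v] : C`_k * 'X != 0 by rewrite mulf_neq0 ?polyX_eq0.
rewrite rootE hornerM hornerX mulf_eq0 negb_or => /andP[cv v0].
case/negP: cv; rewrite -[_.[v]]/(horner_eval v _) -coef_map h1 ?coef0 //.
by move=> a; rewrite a in na.
Qed.

Lemma fibre_vanish (s : seq 'X_{1..N}) (C : 'X_{1..N} -> {poly {poly K}}) u v :
  (aff -> v = 1) -> (forall i, al i * u + be i * v != 0) ->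
  uniq s -> (forall mu, mu \in s -> reduced blk l mu) ->
  (forall p, (forall k, p (g k) != 0) -> p U = u -> p V = v ->
    p (\sum_(mu <- s) mmap1 g mu * eval2 (C mu)) = 0) ->
  forall mu, mu \in s -> (C mu).[u%:P].[v] = 0.
Proof.
move=> av y0 us rs h.
apply: (reduced_independent charK l_gt0 blk_surj y0 us rs) => x x0 xy.
have [p [px pu pv]] := pres_point presR av xy.
rewrite -[RHS](h p) // => [|k]; last by rewrite px.
rewrite rmorph_sum; apply: eq_bigr => mu _.
rewrite mulrC [RHS]rmorphM [X in _ = X * _]point_mmap1.
rewrite [X in _ = _ * X]point_eval2 pu pv.
by congr (_ * _); apply: mmap1_eq.
Qed.

(** Plays the part of the Nullstellensatz and of reducedness: the coefficients of a normal form
    vanish at all good [(u, v)], hence as elements of [R]. The condition on [U] will make [U]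
    nonzero along a curve. *)
Lemma good_points_separate f :
  (forall p, p U != 0 -> (forall k, p (g k) != 0) -> p f = 0) -> f = 0.
Proof.
have [s [C [us rs ->]]] := normal_form f => h.
rewrite big_seq big1 // => mu mus; rewrite (eval2_eq0 _) ?mulr0 // => u v av u0 y0.
apply: (fibre_vanish av y0 us rs) mus => p pg pu pv.
by apply: h => //; rewrite pu.
Qed.

Lemma points_separate f : (forall p, p f = 0) -> f = 0.
Proof. by move=> h; apply: good_points_separate. Qed.

(* [U] and [V] form a regular sequence: [R] is free over [K[U, V]] on the
   reduced monomials. *)
Lemma dvd_coordinate f b : ~~ aff -> V * f = U * b -> exists f', f = U * f'.
Proof.
have [s [C [us rs ->]]] := normal_form f => na e.
have av (v : K) : aff -> v = 1 by move=> a; rewrite a in na.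
have C0 mu : mu \in s -> (C mu).[0] = 0.
  move=> mus; apply/eqP/negPn/negP => c0.
  have /closed_nonrootP[v] : (C mu).[0] * 'X != 0 by rewrite mulf_neq0 ?polyX_eq0.
  rewrite rootE hornerM hornerX mulf_eq0 negb_or => /andP[cv v0]; case/negP: cv.
  suff: (C mu).[0%:P].[v] = 0 by rewrite polyC0 => ->.
  (* Over [(0, v)] the block monomials take the nonzero values [be i * v], and the hypothesis
     becomes [v * f = 0] there. *)
  apply: (fibre_vanish (av v) _ us rs) mus => [i|p pg pu pv].
    by rewrite mulr0 add0r mulf_neq0.
  have : p V * p (\sum_(mu <- s) mmap1 g mu * eval2 (C mu)) = p U * p b.
    by rewrite -!rmorphM e.
  rewrite pu pv mul0r => /eqP.
  by rewrite mulf_eq0 (negPf v0) => /eqP.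
have /choice[w wP] : forall mu, exists w, mu \in s -> C mu = w * 'X.
  move=> mu; have [/C0 c0|_] := boolP (mu \in s); last by exists 0.
  have /factor_theorem[w ->] : root (C mu) 0 by rewrite rootE c0.
  by exists w; rewrite subr0.
exists (\sum_(mu <- s) mmap1 g mu * eval2 (w mu)).
rewrite mulr_sumr; apply: eq_big_seq => mu mus.
by rewrite wP // rmorphM eval2X mulrA mulrC.
Qed.

(** The polynomial [rep f] representing [f] is an arbitrary choice. At a point of [R'] the result is
    the value of [f] at the corresponding point of [R], so neither the choice nor the relations need
    to be examined. *)
Lemma lrmorphism_exists (R' : comAlgType K) (F : 'I_N -> R') :
  (forall f : R', (forall p : point R', p f = 0) -> f = 0) ->
  (forall p : point R', exists q, forall k, q (g k) = p (F k)) ->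
  exists phi : {lrmorphism R -> R'}, forall k, phi (g k) = F k.
Proof.
move=> sepR' h; have /choice[rep repP] := pres_gen presR.
pose phi f : R' := mmap (in_alg R') F (rep f).
have phiP (p : point R') q : (forall k, q (g k) = p (F k)) ->
    forall f, p (phi f) = q f.
  move=> qp f; rewrite [in RHS](repP f) /phi !point_mmap.
  by apply: meval_eq => k; rewrite qp.
have eqP (a b : R') : (forall p : point R', p a = p b) -> a = b.
  move=> e; apply/eqP; rewrite -subr_eq0; apply/eqP/sepR' => p.
  by rewrite rmorphB /= e subrr.
have phi_lin : linear phi.
  move=> c a b; apply: eqP => p; have [q /phiP qp] := h p.
  by rewrite linearP /= !qp linearP.
have phi_mul : monoid_morphism phi.
  split=> [|a b]; apply: eqP => p; have [q /phiP qp] := h p.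
    by rewrite qp !rmorph1.
  by rewrite [RHS]rmorphM /= !qp rmorphM.
pose phiL := GRing.isLinear.Build K R R' _ phi phi_lin.
pose phiM := GRing.isMonoidMorphism.Build R R' phi phi_mul.
pose Phi : {lrmorphism R -> R'} := HB.pack phi phiL phiM.
exists Phi => k; apply: eqP => p; have [q qp] := h p.
by rewrite [LHS](phiP p q).
Qed.

(** Allows an automorphism to be given by its effect [F] on the coordinates of points, together with
    an inverse [G]. *)
Lemma automorphism_same_orbit (F G : 'I_N -> R) :
  (forall p, exists q, forall k, q (g k) = p (F k)) ->
  (forall p, exists q, forall k, q (g k) = p (G k)) ->
  (forall p q, (forall k, q (g k) = p (F k)) -> forall k, q (G k) = p (g k)) ->
  (forall p q, (forall k, q (g k) = p (G k)) -> forall k, q (F k) = p (g k)) ->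
  forall p q, (forall k, q (g k) = p (F k)) -> same_orbit p q.
Proof.
move=> hF hG FG GF.
have [phi phiP] := lrmorphism_exists points_separate hF.
have [psi psiP] := lrmorphism_exists points_separate hG.
have eqP (a b : R) : (forall p, p a = p b) -> a = b.
  move=> e; apply/eqP; rewrite -subr_eq0; apply/eqP/points_separate => p.
  by rewrite rmorphB /= e subrr.
have can1 : cancel phi psi.
  move=> f; apply: eqP => p; pose p1 : point R := p \o psi.
  pose p2 : point R := p1 \o phi; rewrite -[LHS]/(p2 f); apply: point_ext => k.
  rewrite /p2 /= phiP; apply: (GF p p1) => j; by rewrite /p1 /= psiP.
have can2 : cancel psi phi.
  move=> f; apply: eqP => p; pose p1 : point R := p \o phi.
  pose p2 : point R := p1 \o psi; rewrite -[LHS]/(p2 f); apply: point_ext => k.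
  rewrite /p2 /= psiP; apply: (FG p p1) => j; by rewrite /p1 /= phiP.
move=> p q qp; exists phi; first by exists psi.
move=> f; pose p1 : point R := p \o phi.
by rewrite -[RHS]/(p1 f); apply: point_ext => k; rewrite /p1 /= phiP.
Qed.

End Presentation.

Section Orbits.
Variables (K : closedFieldType) (R : comAlgType K).
Implicit Types p q r : point R.

Lemma same_orbit_trans p q r : same_orbit p q -> same_orbit q r -> same_orbit p r.
Proof.
case=> phi bphi hphi [psi bpsi hpsi]; exists (phi \o psi); first exact: bij_comp.
by move=> f; rewrite hpsi hphi.
Qed.

Lemma same_orbit_sym p q : same_orbit p q -> same_orbit q p.
Proof.
case=> phi [psi K1 K2] hphi.
have lin : linear psi by move=> c a b; rewrite -[RHS]K1 linearP /= !K2.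
have mul : monoid_morphism psi.
  by split=> [|a b]; rewrite -[RHS]K1 ?rmorph1 // rmorphM /= !K2.
pose L := GRing.isLinear.Build K R R _ psi lin.
pose M := GRing.isMonoidMorphism.Build R R psi mul.
pose Psi : {lrmorphism R -> R} := HB.pack psi L M.
by exists Psi => [|f]; [exists phi | rewrite hphi [phi _]K2].
Qed.

(** One representative per class; [p0] is the default for classes that contain no point. *)
Lemma finitely_many_orbits_of_classes (C : finType) (p0 : point R)
    (cls : point R -> C) :
  (forall p q, cls p = cls q -> same_orbit p q) -> finitely_many_orbits R.
Proof.
move=> h; have /choice[x xP] : forall c, exists x, forall q, cls q = c -> cls x = c.
  move=> c; have [[p pc]|n] := pselect (exists p, cls p = c); first by exists p.
  by exists p0 => q qc; case: n; exists q.
exists #|C|, (fun i => x (enum_val i)) => y; exists (enum_rank (cls y)).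
by apply: h; rewrite enum_rankK; apply: xP.
Qed.

End Orbits.

Lemma deriv_eq0 (K : closedFieldType) (charK : [pchar K] =i pred0) (p : {poly K}) :
  p^`() = 0 -> (size p <= 1)%N.
Proof.
move=> h; apply/leq_sizeP => -[//|i] _; have := congr1 (coefp i) h.
rewrite /= coef_deriv coef0 -mulr_natr => /eqP.
by rewrite mulf_eq0 ((pcharf0P K).1 charK) orbF => /eqP.
Qed.

(** * A nonzero locally nilpotent derivation changes the ratio of the coordinates *)

Section MovingPoint.
Variables (K : closedFieldType) (charK : [pchar K] =i pred0).
Variables (I : finType) (aff : bool) (al be : I -> K).
Hypothesis be_neq0 : forall i, be i != 0.
Variables (N : nat) (blk : 'I_N -> option I) (l : 'I_N -> nat).
Hypothesis l_gt0 : forall k, (0 < l k)%N.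
Hypothesis blk_surj : forall i, exists k, blk k = Some i.
Hypothesis no_free_variable : forall k, blk k <> None.
Variables (R : comAlgType K) (g : 'I_N -> R) (U V : R).
Hypothesis presR : presentation aff al be blk l g U V.
Variable D : R -> R.
Hypotheses (derD : derivation D) (lnD : locally_nilpotent D).

Lemma derivation_generators : (forall k, D (g k) = 0) -> forall f, D f = 0.
Proof.
move=> h f; have [P ->] := pres_gen presR f.
rewrite /mmap (derivation_sum derD) big1 // => mu _.
rewrite /= mulr_algl (derivationZ derD) -[RHS](scaler0 _ P@_mu); congr (_ *: _).
have DM a b : D a = 0 -> D b = 0 -> D (a * b) = 0.
  by move=> ha hb; rewrite (derivationM derD) ha hb mulr0 mul0r addr0.
apply: (big_ind (fun a => D a = 0)) => [|//|k _]; first exact: derivation1.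
elim: (mu k) => [|n IH]; first exact: derivation1.
by rewrite exprS; apply: DM.
Qed.

(* Otherwise [V * D U = U * D V], so [U] divides [D U]. Then [U] is constant
   along each orbit of [exp(t D)] through a good point, hence so is [V] and so
   is every block monomial; a polynomial dividing a nonzero constant being
   constant, so is every generator. *)
Lemma moving_point : ~ (forall f, D f = 0) ->
  exists p : point R, p (D U) * p V != p U * p (D V) :> K.
Proof.
move=> D0; apply: contrapT => np; apply: D0; apply: derivation_generators.
have e : V * D U = U * D V.
  apply/eqP; rewrite -subr_eq0; apply/eqP.
  apply: (points_separate charK be_neq0 l_gt0 blk_surj presR) => p.
  apply/eqP/negPn/negP => h; apply: np; exists p.
  by rewrite -subr_eq0; apply: contra h => h; rewrite rmorphB !rmorphM /= mulrC.
have [f' Uf'] : exists f', D U = U * f'.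
  have [a|na] := boolP aff.
    exists 0; rewrite mulr0; move: e.
    by rewrite (pres_aff presR a) (derivation1 derD) mulr0 mul1r.
  exact: (dvd_coordinate charK be_neq0 l_gt0 blk_surj presR na e).
move=> k; apply: (good_points_separate charK be_neq0 l_gt0 blk_surj presR) => p pU pg.
pose c := curve lnD p.
have cd f : (c f)^`() = c (D f) by apply: curve_deriv.
have U0 : c U != 0.
  by apply: contraNneq pU => h; rewrite -(curve_at0 derD lnD) -/(c U) h horner0.
have dU : (c U)^`() = 0.
  have cUf : c (D U) = c U * c f' by rewrite Uf'; apply: curveM.
  have [f0|fn0] := eqVneq (c f') 0; first by rewrite cd cUf f0 mulr0.
  (* A nonzero [c (D U)] would be a multiple of [c U], yet as its derivative it has smaller size. *)
  have := lt_size_deriv U0; rewrite cd cUf size_mul // -subn1 ltnNge.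
  by rewrite -addnBA ?size_poly_gt0 // leq_addr.
have dV : (c V)^`() = 0.
  have : c V * c (D U) = c U * c (D V) by rewrite -!(curveM charK derD) e.
  rewrite -cd dU mulr0 => /esym/eqP; rewrite mulf_eq0 (negPf U0) -cd.
  by move=> /eqP.
case bk : (blk k) (no_free_variable (k := k)) => [i|] // _.
have sy : (size (c (mmap1 g (block_mon blk l i))) <= 1)%N.
  rewrite (pres_rel presR); apply: (deriv_eq0 charK).
  rewrite /c (curveP derD) curveZ // derivD !derivZ -/(c U) -/(c V).
  by rewrite dU dV !scaler0 addr0.
have y0 : c (mmap1 g (block_mon blk l i)) != 0.
  have : p (mmap1 g (block_mon blk l i)) != 0.
    by rewrite point_mmap1; apply: mmap1_neq0.
  by apply: contraNneq => h; rewrite -(curve_at0 derD lnD) -/(c _) h horner0.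
have dk : c (g k) %| c (mmap1 g (block_mon blk l i)).
  rewrite /c curve_prod // (bigD1 k) //= mnmE bk eqxx mul1n curveX //.
  by apply/dvdp_mulr/dvdp_exp => //.
(* The coefficient of degree 1 of [c (g k)] is [p (D (g k))]. *)
have := leq_trans (dvdp_leq y0 dk) sy => /leq_sizeP/(_ 1%N isT).
by rewrite /c (coef_curve derD) factS fact0 muln1 divr1.
Qed.

End MovingPoint.

(** * Orbits *)

Section Torus.
Variables (K : closedFieldType) (charK : [pchar K] =i pred0).
Variables (I : finType) (aff : bool) (al be : I -> K).
Hypothesis be_neq0 : forall i, be i != 0.
Variables (N : nat) (blk : 'I_N -> option I) (l : 'I_N -> nat).
Hypothesis l_gt0 : forall k, (0 < l k)%N.
Hypothesis blk_surj : forall i, exists k, blk k = Some i.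
Variables (R : comAlgType K) (g : 'I_N -> R) (U V : R).
Hypothesis presR : presentation aff al be blk l g U V.
Implicit Types p q : point R.

Let yval p i : K := mmap1 (fun k => p (g k) : K) (block_mon blk l i).

(** Scaling all block monomials by one factor [lam] scales [(U, V)] and respects the plane; [V = 1]
    forces [lam = 1]. The translations touch only free variables, which occur in no block
    monomial. *)
Lemma affine_transform (t s : 'I_N -> K) lam :
  (aff -> lam = 1) -> (forall i, mmap1 t (block_mon blk l i) = lam) ->
  (forall k, blk k -> s k = 0) ->
  forall p, exists q, forall k, q (g k) = p (t k *: g k + (s k)%:A).
Proof.
move=> al1 tl s0 p.
have [|i|q [qx _ _]] := @pres_point _ _ _ _ _ _ _ _ _ _ _ _ presR
  (fun k => p (t k *: g k + (s k)%:A)) (lam * p U) (lam * p V).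
- by move=> a; rewrite al1 // mul1r (point_aff presR).
- rewrite (_ : mmap1 _ _ = mmap1 (fun k => t k * (p (g k) : K)) (block_mon blk l i)).
    by rewrite mmap1M tl (point_block presR); ring.
  apply: eq_mmap1_block => k bk.
  by rewrite s0 ?bk // scale0r addr0 pointZ.
- by exists q.
Qed.

(** Take [t] to be the quotient of the coordinates where they are nonzero. On a block without zeros
    its block monomial is then automatically [lam]; on the others a vanishing coordinate can be
    rescaled freely to reach [lam]. Free variables are matched by translations. *)
Lemma torus_same_orbit p q lam : lam != 0 ->
  (forall k, blk k -> (p (g k) == 0) = (q (g k) == 0)) ->
  q U = lam * p U -> q V = lam * p V -> same_orbit p q.
Proof.
move=> lam0 pq qU qV.
have aff1 : aff -> lam = 1.
  by move=> a; move: qV; rewrite !(point_aff presR) // mulr1.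
have yq i : yval q i = lam * yval p i.
  by rewrite /yval !(point_block presR) qU qV; ring.
pose t0 k : K := if blk k is Some _ then
  if p (g k) == 0 then 1 else (q (g k) : K) / p (g k) else 1.
have t00 k : t0 k != 0.
  rewrite /t0; case bk : (blk k) => [i|]; rewrite ?oner_neq0 //.
  case: ifPn => [_|pk]; first exact: oner_neq0.
  by rewrite mulf_neq0 ?invr_eq0 // -pq ?bk.
have t0pq k : blk k -> t0 k * p (g k) = q (g k).
  move=> bk; have e := pq k bk; rewrite /t0; case: (blk k) bk => // i _.
  case: eqP e => [-> /esym/eqP -> | /eqP pk _]; first by rewrite mulr0.
  by rewrite divfK.
(* [rz i] is the coordinate of block [i] to correct, with its factor: an [l]-th root at a vanishing
   coordinate, or 1 if the block has no zero. *)
have /choice[rz rzP] : forall i, exists rz : 'I_N * K,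
    [/\ blk rz.1 = Some i, rz.2 != 0, p (g rz.1) = 0 \/ rz.2 = 1 &
        mmap1 t0 (block_mon blk l i) * rz.2 ^+ l rz.1 = lam].
  move=> i; have w0 := mmap1_neq0 (block_mon blk l i) t00.
  have [[k bk pk]|n] := pselect (exists2 k, blk k = Some i & p (g k) = 0).
    have [z zl] := exists_nth_root (lam / mmap1 t0 (block_mon blk l i)) (l_gt0 k).
    exists (k, z); split=> //=; last by rewrite zl mulrC divfK.
      apply: contraNneq lam0 => z0; move: zl; rewrite z0 expr0n gtn_eqF // => /esym/eqP.
      by rewrite mulf_eq0 invr_eq0 (negPf w0) orbF.
    by left.
  have [k bk] := blk_surj i; exists (k, 1); split=> //=; first exact: oner_neq0.
    by right.
  rewrite expr1n mulr1; apply/(mulIf (_ : yval p i != 0)).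
    by apply/eqP => /mmap1_block_eq0 h; apply: n; apply: h.
  rewrite -yq /yval -mmap1M; apply: eq_mmap1_block => j bj.
  by apply: t0pq; rewrite bj.
pose t k := t0 k *
  (if blk k is Some i then if k == (rz i).1 then (rz i).2 else 1 else 1).
have t_neq0 k : t k != 0.
  rewrite mulf_neq0 //; case: (blk k) => [i|]; last exact: oner_neq0.
  by case: ifP => _; rewrite ?oner_neq0 //; case: (rzP i).
have tl i : mmap1 t (block_mon blk l i) = lam.
  rewrite mmap1M (mmap1_representatives l (fun i => (rz i).2)).
    by case: (rzP i).
  by move=> j; case: (rzP j).
have tpq k : blk k -> t k * p (g k) = q (g k).
  move=> bk; rewrite /t mulrAC t0pq //; case bk' : (blk k) bk => [i|] // _.
  case: eqP => [ki|]; last by rewrite mulr1.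
  have [_ _ [pk0|->] _] := rzP i; last by rewrite mulr1.
  have /eqP -> : q (g k) == 0 by rewrite -pq ?bk' // ki pk0.
  by rewrite mul0r.
pose s k : K := if blk k is Some _ then 0 else (q (g k) : K) - p (g k).
have s0 k : blk k -> s k = 0 by rewrite /s; case: (blk k).
have tV0 k : (t k)^-1 != 0 by rewrite invr_eq0.
have tVl i : mmap1 (fun k => (t k)^-1) (block_mon blk l i) = lam^-1.
  apply: (mulfI lam0); rewrite divff // -[X in X * _](tl i) -mmap1M.
  by rewrite /mmap1 big1 // => k _; rewrite divff // expr1n.
have ext (x : point R) (a b : K) k : x (a *: g k + b%:A) = a * x (g k) + b.
  by rewrite rmorphD /= point_scalar pointZ.
apply: (automorphism_same_orbit charK be_neq0 l_gt0 blk_surj presR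
  (F := fun k => t k *: g k + (s k)%:A)
  (G := fun k => (t k)^-1 *: g k + (- s k / t k)%:A)).
- exact: affine_transform aff1 tl s0.
- apply: affine_transform tVl _ => [a|k bk]; first by rewrite (aff1 a) invr1.
  by rewrite s0 // oppr0 mul0r.
- by move=> x x' hx k; rewrite ext hx ext; field.
- by move=> x x' hx k; rewrite ext hx ext; field.
move=> k; rewrite ext; case bk : (blk k) => [i|].
  by rewrite s0 ?bk // addr0 tpq ?bk.
by rewrite /s /t /t0 bk !mul1r addrC subrK.
Qed.

End Torus.

(** * Carrying the flow from [Y(A)] to [X(A)] and counting orbits *)

Section FiniteOrbits.
Variables (K : closedFieldType) (charK : [pchar K] =i pred0).
Variables (I : finType) (aff : bool) (al be : I -> K).
Hypothesis be_neq0 : forall i, be i != 0.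
Variables (N : nat) (blk : 'I_N -> option I) (l : 'I_N -> nat).
Hypothesis l_gt0 : forall k, (0 < l k)%N.
Hypothesis blk_surj : forall i, exists k, blk k = Some i.
Variables (R : comAlgType K) (g : 'I_N -> R) (U V : R).
Hypothesis presR : presentation aff al be blk l g U V.
Variables (N0 : nat) (j : 'I_N0 -> 'I_N) (e : 'I_N -> option 'I_N0).
Hypotheses (jK : pcancel j e) (eK : ocancel e j).
Hypothesis blk_e : forall k, (e k : bool) = blk k.
Variables (R0 : comAlgType K) (g0 : 'I_N0 -> R0) (U0 V0 : R0).
Hypothesis presR0 : presentation aff al be (blk \o j) (l \o j) g0 U0 V0.

Lemma mmap1_block_restrict (x : 'I_N -> K) i :
  mmap1 (x \o j) (block_mon (blk \o j) (l \o j) i) = mmap1 x (block_mon blk l i).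
Proof.
rewrite [RHS]/mmap1 (bigID (fun k => e k : bool)) /= [X in _ * X]big1 ?mulr1.
  rewrite (reindex_omap j e) => [|k]; last by case: (e k) (eK k) => //= k0 ->.
  apply: eq_big => [k|k _]; first by rewrite jK eqxx.
  by rewrite !mnmE.
by move=> k; rewrite blk_e mnmE; case: (blk k).
Qed.

Lemma restrict_point (p : point R) : exists q : point R0,
  [/\ forall k, q (g0 k) = p (g (j k)), q U0 = p U & q V0 = p V].
Proof.
apply: (pres_point presR0) => [|i]; first exact: (point_aff presR).
by rewrite -(point_block presR) -mmap1_block_restrict.
Qed.

Lemma extend_point (q : point R0) (x : 'I_N -> K) : exists p : point R,
  [/\ forall k, p (g (j k)) = q (g0 k), forall k, ~~ blk k -> p (g k) = x k,
      p U = q U0 & p V = q V0].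
Proof.
pose y k : K := if e k is Some k0 then q (g0 k0) else x k.
have yj k : y (j k) = q (g0 k) by rewrite /y jK.
have [|i|p [py pU pV]] := @pres_point _ _ _ _ _ _ _ _ _ _ _ _ presR y (q U0) (q V0).
- exact: (point_aff presR0).
- rewrite -(point_block presR0) -mmap1_block_restrict.
  by apply: eq_bigr => k _; rewrite /= yj.
exists p; split=> // k; rewrite py //.
by rewrite -blk_e /y; case: (e k).
Qed.

Let blk0_surj i : exists k, (blk \o j) k = Some i.
Proof.
have [k bk] := blk_surj i; have := blk_e k; have := eK k.
by case: (e k) => [k0 /= ke _|]; [exists k0; rewrite /= ke | rewrite bk].
Qed.

Let l0_gt0 k : (0 < (l \o j) k)%N.
Proof. exact: l_gt0. Qed.

Variable D : R0 -> R0.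
Hypotheses (derD : derivation D) (lnD : locally_nilpotent D).

(** The automorphism is [exp(c D)] on the block variables, transported by [iota] (dual to the
    projection to [Y(A)]), and the identity on the free ones. *)
Lemma exp_same_orbit c (p q : point R) (p0 q0 : point R0) :
  (forall k, p (g (j k)) = p0 (g0 k)) -> (forall k, q (g (j k)) = q0 (g0 k)) ->
  (forall k, ~~ blk k -> q (g k) = p (g k)) ->
  (forall f, q0 f = (curve lnD p0 f).[c]) -> same_orbit p q.
Proof.
have sep0 := points_separate charK be_neq0 l0_gt0 blk0_surj presR0.
have sep := points_separate charK be_neq0 l_gt0 blk_surj presR.
have [iota iotaP] : exists iota : {lrmorphism R0 -> R}, forall k, iota (g0 k) = g (j k).
  apply: (lrmorphism_exists presR0 sep) => x.
  by have [y [yx _ _]] := restrict_point x; exists y.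
have [E hE] := exp_exists charK derD lnD sep0 c.
have [F hF] := exp_exists charK derD lnD sep0 (- c).
have EF : cancel E F := exp_inverse charK derD sep0 hE hF.
have FE : cancel F E.
  by apply: (exp_inverse charK derD sep0 (c := - c)) => // x f; rewrite opprK.
pose ext (G : {lrmorphism R0 -> R0}) k :=
  if e k is Some k0 then iota (G (g0 k0)) else g k.
have extP (G : {lrmorphism R0 -> R0}) (x : point R) :
    exists y : point R, forall k, y (g k) = x (ext G k).
  pose x0 : point R0 := x \o (iota \o G).
  have [y [yx ys _ _]] := extend_point x0 (fun k => x (g k)).
  exists y => k; rewrite /ext; have := eK k; have := ys k; rewrite -blk_e.
  by case: (e k) => [k0 _ /= <-|/(_ isT)].
have extK (G H : {lrmorphism R0 -> R0}) : cancel H G -> forall x y : point R,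
    (forall k, y (g k) = x (ext G k)) -> forall k, y (ext H k) = x (g k).
  move=> GH x y yx k; rewrite /ext; have := eK k; have := yx k; rewrite /ext.
  case: (e k) => [k0 _ /= <-|//]; rewrite -iotaP -{2}(GH (g0 k0)).
  pose y0 : point R0 := y \o iota; pose x0 : point R0 := x \o (iota \o G).
  rewrite -[LHS]/(y0 _) -[RHS]/(x0 _); apply: (point_ext presR0) => i.
  by rewrite /y0 /x0 /= iotaP yx /ext jK.
move=> pp0 qq0 pq q0E.
apply: (automorphism_same_orbit charK be_neq0 l_gt0 blk_surj presR
  (extP E) (extP F) (extK E F FE) (extK F E EF)) => k.
rewrite /ext; have := eK k; have := pq k; rewrite -blk_e.
case: (e k) => [k0 _ /= <-|/(_ isT) //].
rewrite qq0 q0E -hE; pose p1 : point R0 := p \o iota.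
rewrite -[RHS]/(p1 _); apply: (point_ext presR0) => i.
by rewrite /p1 /= iotaP pp0.
Qed.

Let zeros (p : point R) := [set k | blk k && (p (g k) == 0)].

(** All block monomials vanish at [p], hence at [q]. So some point has the coordinates of [q] and
    [U = V = 0]; being determined by its coordinates, it agrees with [q]. *)
Lemma coordinates_eq0 (p q : point R) : zeros p = zeros q ->
  p U = 0 -> p V = 0 -> q U = 0 /\ q V = 0.
Proof.
move=> /setP pq pU pV.
have naff : aff -> (0 : K) = 1 by move=> a; rewrite -pV (point_aff presR).
have [i|q' [q'q q'U q'V]] := @pres_point _ _ _ _ _ _ _ _ _ _ _ _ presR
    (fun k => q (g k)) 0 0 naff; last first.
  by split; [rewrite -q'U | rewrite -q'V]; apply: (point_ext presR) => k; rewrite q'q.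
rewrite !mulr0 addr0. apply/(mmap1_block_eq0 blk l_gt0).
have /(mmap1_block_eq0 blk l_gt0)[k bk pk] :
    mmap1 (fun k => p (g k) : K) (block_mon blk l i) = 0.
  by rewrite (point_block presR) pU pV !mulr0 addr0.
by exists k => //; have := pq k; rewrite !inE bk pk eqxx => /esym/eqP.
Qed.

(** A zero in block [i] puts [(U, V)] on the line [al i * U + be i * V = 0], where [U] determines
    [V]. So [(U, V)] at [p] and at [q] are proportional, the case of the origin being decided by the
    zero pattern. *)
Lemma same_zeros_same_orbit (p q : point R) k :
  zeros p = zeros q -> k \in zeros p -> same_orbit p q.
Proof.
move=> zpq; have zqp := esym zpq; have /setP pq := zpq => kp.
have pq0 k' : blk k' -> (p (g k') == 0) = (q (g k') == 0).
  by move=> bk; have := pq k'; rewrite !inE bk.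
have kq : k \in zeros q by rewrite -pq.
move: kp kq; rewrite !inE; case bk : (blk k) => [i|] //= /eqP pk /eqP qk.
have line (x : point R) : x (g k) = 0 -> x V = - (al i / be i) * x U.
  move=> xk; have /(mmap1_block_eq0 blk l_gt0) :
      exists2 k, blk k = Some i & x (g k) = 0.
    by exists k.
  move=> y0; have := point_block presR x i; rewrite y0.
  move/esym/eqP; rewrite addrC addr_eq0 => /eqP y1; apply: (mulfI (be_neq0 i)).
  by rewrite y1; field.
have tor := torus_same_orbit charK be_neq0 l_gt0 blk_surj presR.
have [pU|pU] := eqVneq (p U : K) 0.
  have pV : p V = 0 by rewrite (line p) // pU mulr0.
  have [qU qV] := coordinates_eq0 zpq pU pV.
  by apply: (tor _ _ 1) => //; rewrite ?oner_neq0 ?mul1r ?pU ?pV.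
have qU : (q U : K) != 0.
  apply: contraNneq pU => qU; have qV : q V = 0 by rewrite (line q) // qU mulr0.
  by have [->] := coordinates_eq0 zqp qU qV.
apply: (tor _ _ ((q U : K) / p U)) => //; first by rewrite mulf_neq0 ?invr_eq0.
  by rewrite divfK.
by rewrite (line q) // (line p) // mulrCA divfK.
Qed.

Variable i0 : I.
Hypothesis D_neq0 : ~ (forall f, D f = 0).

Theorem finitely_many_orbits_of_LND : finitely_many_orbits R.
Proof.
have no_free k : (blk \o j) k <> None.
  by have := blk_e (j k); rewrite jK /=; case: (blk (j k)).
have [p0 w] := moving_point charK be_neq0 l0_gt0 blk0_surj no_free presR0
  derD lnD D_neq0.
pose u := curve lnD p0 U0; pose v := curve lnD p0 V0.
have [S SP] : exists S : seq K, forall z, z \notin S ->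
    exists2 t, v.[t] != 0 & u.[t] = z * v.[t].
  (* At parameter 0, the Wronskian of [u] and [v] is the difference that [w] says is nonzero. *)
  apply: ratio_cofinite; apply: contraNneq w => /(congr1 (horner^~ 0)).
  by rewrite !curve_deriv // !hornerM !curve_at0 // => ->.
have [P [Pj Ps _ _]] := extend_point p0 (fun=> 0).
have sep0 := points_separate charK be_neq0 l0_gt0 blk0_surj presR0.
have orbit_P t : exists Q : point R, [/\ same_orbit P Q, Q U = u.[t] & Q V = v.[t]].
  have [E hE] := exp_exists charK derD lnD sep0 t.
  pose p1 : point R0 := p0 \o E.
  have [Q [Qj Qs QU QV]] := extend_point p1 (fun=> 0).
  exists Q; split; rewrite ?QU ?QV /p1 /= ?hE //.
  apply: (exp_same_orbit Pj Qj (c := t)) => [k bk|f].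
    by rewrite Ps // Qs.
  exact: hE.
have tor := torus_same_orbit charK be_neq0 l_gt0 blk_surj presR.
have block_neq0 (x : point R) i : zeros x = set0 -> al i * x U + be i * x V != 0.
  move=> x0; rewrite -(point_block presR).
  apply/eqP => /(mmap1_block_eq0 blk l_gt0)[k bk xk].
  by have := in_set0 k; rewrite -x0 inE bk xk eqxx.
have gen_neq0 (x : point R) k : (forall i, al i * x U + be i * x V != 0) -> blk k ->
    (x (g k) == 0) = false.
  move=> x0; case bk : (blk k) => [i|] // _; apply/negP => /eqP xk.
  by have /eqP := x0 i; apply; rewrite -(point_block presR);
    apply/(mmap1_block_eq0 blk l_gt0); exists k.
have generic_P (x : point R) : zeros x = set0 -> x V != 0 :> K ->
    (x U : K) / x V \notin S -> same_orbit P x.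
  move=> x0 xV /SP[t vt ut]; have [Q [PQ QU QV]] := orbit_P t.
  apply: same_orbit_trans PQ _; have lam0 : (x V : K) / v.[t] != 0.
    by rewrite mulf_neq0 ?invr_eq0.
  apply: (tor _ _ _ lam0) => [k bk||]; last 2 first.
  - by rewrite QU ut; field; rewrite xV vt.
  - by rewrite QV; field.
  rewrite !gen_neq0 // => [i|i]; first exact: block_neq0.
  rewrite QU QV ut; have := block_neq0 x i x0; apply: contra => /eqP h.
  have -> : al i * x U + be i * x V =
      (al i * ((x U : K) / x V * v.[t]) + be i * v.[t]) * ((x V : K) / v.[t]).
    by field; rewrite xV vt.
  by rewrite h mul0r.
(* [index] gives every ratio outside [S] the same value [size S], the class of the orbit of [P];
   [V = 0] gets the further value [(size S).+1]. *)
pose ratio (p : point R) := if p V == 0 then (size S).+1 else index ((p U : K) / p V) S.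
have ratio_lt p : (ratio p < (size S).+2)%N.
  by rewrite /ratio; case: ifP => // _; rewrite ltnS ltnW // ltnS index_size.
apply: (@finitely_many_orbits_of_classes _ _ ({set 'I_N} * 'I_(size S).+2)%type P
  (fun p => (zeros p, Ordinal (ratio_lt p)))) => p q [zpq rpq].
have [p0'|[k kp]] := set_0Vmem (zeros p); last exact: same_zeros_same_orbit kp.
have q0' : zeros q = set0 by rewrite -zpq.
have pq0 k : blk k -> (p (g k) == 0) = (q (g k) == 0).
  by move=> bk; have /setP/(_ k) := zpq; rewrite !inE bk.
move: rpq; rewrite /ratio.
case: (eqVneq (p V : K) 0) => pV; case: (eqVneq (q V : K) 0) => qV.
- move=> _; have pU : (p U : K) != 0.
    by apply: contraNneq (block_neq0 p i0 p0') => pU; rewrite pU pV !mulr0 addr0.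
  have qU : (q U : K) != 0.
    by apply: contraNneq (block_neq0 q i0 q0') => qU; rewrite qU qV !mulr0 addr0.
  apply: (tor _ _ ((q U : K) / p U)) => //; first by rewrite mulf_neq0 ?invr_eq0.
    by rewrite divfK.
  by rewrite pV qV mulr0.
- by move=> h; have := index_size ((q U : K) / q V) S; rewrite -h ltnn.
- by move=> h; have := index_size ((p U : K) / p V) S; rewrite h ltnn.
move=> h; have [pS|pS] := boolP ((p U : K) / p V \in S); last first.
  apply: same_orbit_trans (same_orbit_sym (generic_P p p0' pV pS)) _.
  apply: generic_P => //; move: pS; rewrite -!index_mem h //.
have pq : (p U : K) / p V = (q U : K) / q V.
  rewrite -(nth_index 0 pS) h nth_index //; move: pS; rewrite -!index_mem h //.
apply: (tor _ _ ((q V : K) / p V)) => //; first by rewrite mulf_neq0 ?invr_eq0.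
  by rewrite mulrAC -mulrA pq mulrC divfK.
by rewrite divfK.
Qed.

End FiniteOrbits.

(** * Trinomial algebras *)

Section Relations.
Variable K : closedFieldType.

Definition minor k (a : 'M[K]_(2, k)) i j : K := a 0 i * a 1 j - a 0 j * a 1 i.

Lemma free_minor_neq0 k (a : 'M[K]_(2, k)) i j :
  free [:: col i a; col j a] -> minor a i j != 0.
Proof.
move=> /(freeP (X := [tuple col i a; col j a])) fr; apply/eqP => m0.
have dep c d : c *: col i a + d *: col j a = 0 -> c = 0 /\ d = 0.
  move=> cd; have := fr (fun u => if u == 0 then c else d).
  rewrite !big_ord_recl big_ord0 addr0 /= => /(_ cd) h.
  by split; [exact: (h 0)|exact: (h 1)].
have colE c d : c * a 0 i + d * a 0 j = 0 -> c * a 1 i + d * a 1 j = 0 ->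
    c = 0 /\ d = 0.
  move=> h0 h1; apply: dep; apply/matrixP => u v; rewrite !mxE.
  by case: u => -[|[|//]] hu; [rewrite -h0 | rewrite -h1];
    congr (_ * a _ _ + _ * a _ _); apply: val_inj.
(* The combination of columns [i] and [j] with coefficients [a 0 j] and [- a 0 i] has entries 0 and
   [- minor a i j]. *)
have [a0j a0i] : a 0 j = 0 /\ - a 0 i = 0.
  by apply: colE; [ring | rewrite -[RHS]oppr0 -m0 /minor; ring].
have [a1j a1i] : a 1 j = 0 /\ - a 1 i = 0.
  by apply: colE; [rewrite -m0 /minor; ring | ring].
move/eqP: a0i; move/eqP: a1i; rewrite !oppr_eq0 => /eqP a1i /eqP a0i.
have [||/eqP] := colE 1 0; [by rewrite a0i a0j; ring | by rewrite a1i a1j; ring |].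
by rewrite oner_eq0.
Qed.

Lemma det_mx22 (P : comNzRingType) (F : nat -> nat -> P) :
  \det (\matrix_(i < 2, j < 2) F i j) = F 0 0 * F 1 1 - F 0 1 * F 1 0.
Proof.
rewrite (expand_det_row _ 0) !big_ord_recl big_ord0 /cofactor !det_mx11 !mxE /=.
by rewrite /bump /=; ring.
Qed.

Lemma det_mx33 (P : comNzRingType) (F : nat -> nat -> P) :
  \det (\matrix_(i < 3, j < 3) F i j) =
    F 0 0 * (F 1 1 * F 2 2 - F 1 2 * F 2 1)
    - F 0 1 * (F 1 0 * F 2 2 - F 1 2 * F 2 0)
    + F 0 2 * (F 1 0 * F 2 1 - F 1 1 * F 2 0).
Proof.
rewrite (expand_det_row _ 0) !big_ord_recl big_ord0 /cofactor.
have E (j : 'I_3) : row' 0 (col' j (\matrix_(i < 3, j < 3) F i j)) =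
    \matrix_(u < 2, v < 2) F u.+1 (bump j v).
  by apply/matrixP => u v; rewrite !mxE.
rewrite !E !(det_mx22 (fun u v => F u.+1 (bump _ v))) !mxE /= /bump /=; ring.
Qed.

Lemma relation2E (P : comAlgType K) k (a : 'M[K]_(2, k.+2))
    (ha : forall i j, i != j -> free [:: col i a; col j a])
    (T : 'I_k.+2 -> P) (i : 'I_k) :
  trinomial_relation (A := Type2 ha) T i =
    minor a (inord i.+1) (inord i.+2) *: T (inord i)
    - minor a (inord i) (inord i.+2) *: T (inord i.+1)
    + minor a (inord i) (inord i.+1) *: T (inord i.+2).
Proof.
rewrite /=; set M := col_mx _ _.
pose F (u v : nat) : P :=
  if u is u'.+1 then (a (inord u') (inord (i + v)))%:A else T (inord (i + v)).
have -> : M = \matrix_(u < 3, v < 3) F u v.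
  apply/matrixP => u v; rewrite !mxE; case: splitP => u' /= ->; rewrite !mxE.
    by rewrite ord1.
  by rewrite /= inord_val.
rewrite det_mx33 /F addn0 addn1 addn2 /minor /=.
have -> : inord 0 = 0 :> 'I_2 by apply: val_inj; rewrite /= inordK.
have -> : inord 1 = 1 :> 'I_2 by apply: val_inj; rewrite /= inordK.
rewrite -[_ *: T (inord i)]mulr_algl -[_ *: T (inord i.+1)]mulr_algl.
rewrite -[_ *: T (inord i.+2)]mulr_algl.
have AE (x y z w : K) : (x * y - z * w)%:A = x%:A * y%:A - z%:A * w%:A :> P.
  by have := rmorphB (in_alg P) (x * y) (z * w); rewrite !rmorphM.
rewrite !AE; congr (_ - _ + _); exact: mulrC.
Qed.

(** Stated over any algebra [P], so that one formula serves both in the trinomial algebra and, with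
    [P = K^o], at points. *)
Definition affine_form (P : comAlgType K) (J : finType) (c : J -> K) (c0 : K)
    (y : J -> P) : P := \sum_j c j *: y j + c0%:A.

(* The relations say that the vector [y] of block monomials lies on the plane
   spanned by [al] and [be] (on an affine line of it, for type 1).  Its
   coordinates are affine forms in [y], chosen so that no [be i] vanishes. *)
Definition plane_coordinates k (A : trinomial_matrix K k) (aff : bool)
    (al be cU cV : 'I_(nblocks A) -> K) (u0 v0 : K) : Prop :=
  [/\ forall i, be i != 0,
      forall (P : comAlgType K) (y : 'I_(nblocks A) -> P),
        aff -> affine_form cV v0 y = 1,
      forall (P : comAlgType K) (y : 'I_(nblocks A) -> P),
        (forall i, trinomial_relation y i = 0) ->
        forall i, y i = al i *: affine_form cU u0 y + be i *: affine_form cV v0 y &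
      forall (P : comAlgType K) (y : 'I_(nblocks A) -> P) (u v : P),
        (aff -> v = 1) -> (forall i, y i = al i *: u + be i *: v) ->
        [/\ forall i, trinomial_relation y i = 0,
            affine_form cU u0 y = u & affine_form cV v0 y = v]].

(** The relations say that [y i + a i] does not depend on [i]. Writing this constant as [U + e],
    with [e] distinct from every [a i], gives [y i = U + (e - a i)] with nonzero second
    coefficient. *)
Lemma exists_coordinates1 k (a : 'I_k.+1 -> K) (ha : injective a) :
  exists al be cU cV u0 v0,
    plane_coordinates (A := Type1 ha) true al be cU cV u0 v0.
Proof.
have /closed_nonrootP[e] : \prod_i ('X - (a i)%:P) != 0.
  by apply/prodf_neq0 => i _; rewrite polyXsubC_eq0.
rewrite rootE horner_prod => /prodf_neq0 e0.
have U_E (P : comAlgType K) (y : 'I_k.+1 -> P) :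
    affine_form (fun i => (i == ord0)%:R) (a ord0 - e) y = y ord0 + (a ord0 - e)%:A.
  rewrite /affine_form (bigD1 ord0) //= scale1r big1 ?addr0 // => i /negPf ->.
  by rewrite scale0r.
have V_E (P : comAlgType K) (y : 'I_k.+1 -> P) : affine_form (fun=> 0) 1 y = 1.
  by rewrite /affine_form big1 ?add0r ?scale1r // => i _; rewrite scale0r.
exists (fun=> 1), (fun i => e - a i), (fun i => (i == ord0)%:R), (fun=> 0).
exists (a ord0 - e), 1; split=> [i|//|P y|P y u v /(_ isT) -> yE].
- by have := e0 i isT; rewrite !hornerE.
- move=> h i; rewrite U_E V_E scale1r -addrA -scalerDl addrA subrK.
  rewrite -(inord_val i); move: (ltn_ord i); elim: (i : nat) => [_|n IH].
    rewrite (_ : inord 0 = ord0 :> 'I_k.+1) ?subrr ?scale0r ?addr0 //.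
    by apply: val_inj; rewrite /= inordK.
  move=> nk; have /= := h (Ordinal (nk : n < k)%N); rewrite IH; last exact: ltnW.
  move=> hn; rewrite -[LHS]addr0 -hn.
  transitivity (y ord0 +
      ((a ord0 - a (inord n))%:A - (a (inord n.+1) - a (inord n))%:A)).
    by ring.
  by rewrite -scalerBl; congr (_ + _ *: _); ring.
rewrite U_E V_E; split=> // [i|].
  rewrite /= !yE !scale1r opprD addrACA subrr add0r -!scalerBl.
  by rewrite -[RHS](scale0r 1); congr (_ *: _); ring.
by rewrite yE scale1r -addrA -scalerDl addrA subrK subrr scale0r addr0.
Qed.

(** [al] and [be] are the rows of [a] after adding [e] times the first to the second. This keeps all
    minors, and since no column of [a] is zero, some [e] makes every [be i] nonzero. [U] and [V] are
    Cramer's solution from the first two blocks. *)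
Lemma exists_coordinates2 k (a : 'M[K]_(2, k.+2))
    (ha : forall i j, i != j -> free [:: col i a; col j a]) :
  exists al be cU cV u0 v0,
    plane_coordinates (A := Type2 ha) false al be cU cV u0 v0.
Proof.
have m0 i j : i != j -> minor a i j != 0.
  by move=> /ha; apply: free_minor_neq0.
pose o0 : 'I_k.+2 := inord 0; pose o1 : 'I_k.+2 := inord 1.
have o01 : o0 != o1 by rewrite -val_eqE /= !inordK.
have /closed_nonrootP[e] : \prod_i ((a 0 i)%:P * 'X + (a 1 i)%:P) != 0.
  apply/prodf_neq0 => i _; have [j ij] : exists j : 'I_k.+2, i != j.
    by have [->|n0] := eqVneq i o0; [exists o1 | exists o0].
  apply: contra (m0 i j ij) => /eqP h.
  have := congr1 (horner^~ 0) h; have := congr1 (horner^~ 1) h; rewrite !hornerE.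
  rewrite ?(mulr0, add0r, mulr1) => h1 h0; move: h1; rewrite h0 addr0 => h1.
  by rewrite /minor h0 h1 mul0r mulr0 subrr.
rewrite rootE horner_prod => /prodf_neq0 e0.
pose al i : K := a 0 i; pose be i : K := a 1 i + e * a 0 i.
have mE i j : minor a i j = al i * be j - al j * be i by rewrite /minor /al /be; ring.
pose d := minor a o0 o1; have d0 : d != 0 by apply: m0.
pose c x y i : K := if i == o0 then x / d else if i == o1 then y / d else 0.
have cE (P : comAlgType K) x y (z : 'I_k.+2 -> P) :
    affine_form (c x y) 0 z = d^-1 *: (x *: z o0 + y *: z o1).
  rewrite /affine_form scale0r addr0 (bigD1 o0) //= (bigD1 o1) 1?eq_sym //=.
  rewrite big1 ?addr0 => [|i /andP[/negPf i0 /negPf i1]].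
    by rewrite /c !eqxx (eq_sym o1) (negPf o01) scalerDr !scalerA ![d^-1 * _]mulrC.
  by rewrite /c i0 i1 scale0r.
have comb (P : comAlgType K) (u v : P) x y z x1 x2 y1 y2 z1 z2 :
    x *: (x1 *: u + x2 *: v) - y *: (y1 *: u + y2 *: v) + z *: (z1 *: u + z2 *: v)
    = (x * x1 - y * y1 + z * z1) *: u + (x * x2 - y * y2 + z * z2) *: v.
  by rewrite !(scalerDl, scaleNr, scalerDr, scalerA); ring.
exists al, be, (c (be o1) (- be o0)), (c (- al o1) (al o0)), 0, 0.
split=> [i|//|P y|P y u v _ yE].
- by have := e0 i isT; rewrite !hornerE addrC mulrC.
- set u := affine_form _ _ _; set v := affine_form (c (- al o1) _) _ _.
  move=> h i.
  have y0 : y o0 = al o0 *: u + be o0 *: v.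
    rewrite /u /v !cE !scalerA !scalerDr !scalerA.
    transitivity ((d^-1 * (al o0 * be o1 - al o1 * be o0)) *: y o0).
      by rewrite -mE mulVf // scale1r.
    rewrite addrACA -!scalerDl addrC -[LHS]add0r -[X in X + _ = _](scale0r (y o1)).
    by congr (_ *: _ + _ *: _); ring.
  have y1 : y o1 = al o1 *: u + be o1 *: v.
    rewrite /u /v !cE !scalerA !scalerDr !scalerA.
    transitivity ((d^-1 * (al o0 * be o1 - al o1 * be o0)) *: y o1).
      by rewrite -mE mulVf // scale1r.
    rewrite addrACA -!scalerDl -[LHS]add0r -[X in X + _ = _](scale0r (y o0)).
    by congr (_ *: _ + _ *: _); ring.
  rewrite -(inord_val i); move: (ltn_ord i).
  (* Two consecutive values are carried along because the relations are three-term: each determines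
     the next value, with nonzero coefficient [minor a i0 i1]. That [al] and [be] satisfy them is
     the vanishing of a determinant with dependent rows. *)
  suff H n : (n < k.+1)%N -> y (inord n) = al (inord n) *: u + be (inord n) *: v /\
      y (inord n.+1) = al (inord n.+1) *: u + be (inord n.+1) *: v.
    case: (i : nat) => [|n] ni; first by case: (H 0%N isT).
    by case: (H n ni).
  elim: n => [_|n IH nk]; first by split.
  have [yn yn1] := IH (ltnW nk); split=> //.
  have := h (Ordinal (nk : n < k)%N); rewrite relation2E /=.
  set i0 := inord n; set i1 := inord n.+1; set i2 := inord n.+2.
  have m01 : minor a i0 i1 != 0.
    by apply: m0; rewrite -val_eqE /= !inordK // ?ltn_eqF // ltnW // ltnW.
  rewrite yn yn1 => hn; apply: (scalerI m01).
  have := comb P u v (minor a i1 i2) (minor a i0 i2) (minor a i0 i1)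
    (al i0) (be i0) (al i1) (be i1) (al i2) (be i2).
  rewrite (_ : _ * al i0 - _ + _ = 0); last by rewrite !mE; ring.
  rewrite (_ : _ * be i0 - _ + _ = 0); last by rewrite !mE; ring.
  by rewrite !scale0r addr0 -hn => /addrI.
split=> [i||].
- rewrite relation2E !yE comb.
  rewrite (_ : _ * al _ - _ + _ = 0); last by rewrite !mE; ring.
  rewrite (_ : _ * be _ - _ + _ = 0); last by rewrite !mE; ring.
  by rewrite !scale0r addr0.
- have := comb P u v (be o1) (be o0) 0 (al o0) (be o0) (al o1) (be o1) 0 0.
  rewrite cE !yE scaleNr scale0r addr0 => ->; rewrite scalerDr !scalerA.
  rewrite -[RHS]scale1r -[RHS]addr0 -(scale0r v); congr (_ *: _ + _ *: _).
    by rewrite /d mE in d0 *; field.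
  by ring.
have := comb P u v (- al o1) (- al o0) 0 (al o0) (be o0) (al o1) (be o1) 0 0.
rewrite cE !yE !scaleNr opprK scale0r addr0 => ->; rewrite scalerDr !scalerA.
rewrite -[RHS]scale1r -[RHS]add0r -(scale0r u); congr (_ *: _ + _ *: _).
  by ring.
by rewrite /d mE in d0 *; field.
Qed.

End Relations.

Lemma exists_plane_coordinates (K : closedFieldType) k (A : trinomial_matrix K k) :
  exists aff al be cU cV u0 v0, plane_coordinates (A := A) aff al be cU cV u0 v0.
Proof.
case: A => a ha; [exists true; exact: exists_coordinates1 |].
by exists false; apply: exists_coordinates2.
Qed.

Lemma trinomial_relation_morph (K : closedFieldType) (P P' : comAlgType K)
    (f : {lrmorphism P -> P'}) k (A : trinomial_matrix K k)
    (T : 'I_(nblocks A) -> P) i :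
  f (trinomial_relation T i) = trinomial_relation (f \o T) i.
Proof.
case: A T => [a|a] ha T; first by rewrite /= !rmorphB /= linearZ /= rmorph1.
by rewrite !relation2E rmorphD rmorphB /= !linearZ.
Qed.

Lemma affine_form_morph (K : closedFieldType) (P P' : comAlgType K)
    (f : {lrmorphism P -> P'}) (J : finType) (c : J -> K) c0 (y : J -> P) :
  f (affine_form c c0 y) = affine_form c c0 (f \o y).
Proof.
rewrite /affine_form rmorphD rmorph_sum /= linearZ /= rmorph1; congr (_ + _).
by apply: eq_bigr => i _; rewrite linearZ.
Qed.

Section TrinomialPresentation.
Variables (K : closedFieldType) (A : trinomial_data K).
Local Notation I := 'I_(nblocks (tri_A A)).

Definition variable_block m (k : 'I_(nvars A m)) : option I :=
  if split k is inl v then Some (tagnat.sig1 v) else None.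

(** For a free variable, 1 is a default that keeps all exponents positive; [block_mon] multiplies it
    by 0. *)
Definition variable_exponent m (k : 'I_(nvars A m)) : nat :=
  if split k is inl v then tri_l (tagnat.sig2 v) else 1.

Lemma variable_exponent_gt0 m (k : 'I_(nvars A m)) : (0 < variable_exponent k)%N.
Proof. by rewrite /variable_exponent; case: split => // v; apply: tri_l_gt0. Qed.

Lemma variable_block_surj m i : exists k : 'I_(nvars A m), variable_block k = Some i.
Proof.
exists (lshift m (tagnat.Rank i (Ordinal (tri_n_gt0 i)))).
by rewrite /variable_block (unsplitK (inl _)) tagnat.Rank1K.
Qed.

Lemma mmap1_variable_block m (S : comNzRingType) (y : 'I_(nvars A m) -> S) i :
  mmap1 y (block_mon (@variable_block m) (@variable_exponent m) i) =
  \prod_(j < tri_n i) y (lshift m (tagnat.Rank i j)) ^+ tri_l j.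
Proof.
rewrite /mmap1 big_split_ord /= [X in _ * X]big1 ?mulr1 => [|w _]; last first.
  by rewrite mnmE /variable_block (unsplitK (inr _)).
rewrite (reindex _ tagnat.rank_bij_on) /=.
transitivity (\prod_(s : {i : I & 'I_(tri_n i)})
    (if tag s == i then y (lshift m (tagnat.rank s)) ^+ tri_l (tagged s) else 1)).
  apply: eq_bigr => s _; rewrite mnmE /variable_block /variable_exponent.
  rewrite (unsplitK (inl _)) /tagnat.sig1 /tagnat.sig2 tagnat.rankK.
  rewrite (_ : (Some _ == Some _) = (tag s == i)) //.
  by case: (tag s == i); rewrite ?mul1n.
transitivity (\prod_(i' : I) \prod_(j < tri_n i')
    (if i' == i then y (lshift m (tagnat.Rank i' j)) ^+ tri_l j else 1)).
  by rewrite sig_big_dep; apply: eq_bigr => -[i' j'].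
rewrite (bigD1 i) //= eqxx [X in _ * X]big1 ?mulr1 // => i' /negPf ne.
by rewrite big1 // => j _; rewrite ne.
Qed.

Local Notation piR m := (\pi_({ideal_quot (@trinomial_ideal K A m)})).

Definition generator m (k : 'I_(nvars A m)) : trinomial_algebra A m := piR m 'X_k.

Lemma mmap1_generator m i :
  mmap1 (@generator m) (block_mon (@variable_block m) (@variable_exponent m) i) =
  piR m (monT m i).
Proof.
rewrite mmap1_variable_block /monT rmorph_prod; apply: eq_bigr => j _.
by rewrite rmorphXn.
Qed.

Lemma generator_mmap m (P : {mpoly K[nvars A m]}) :
  piR m P = mmap (in_alg (trinomial_algebra A m)) (@generator m) P.
Proof.
rewrite [P in LHS]mpolyE rmorph_sum; apply: eq_bigr => mu _.
rewrite /= quot_pi_scale mulr_algl; congr (_ *: _).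
rewrite mpolyXE_id rmorph_prod; apply: eq_bigr => k _.
by rewrite rmorphXn.
Qed.

Lemma trinomial_relation_pi m i :
  trinomial_relation (fun b => piR m (monT m b)) i = 0 :> trinomial_algebra A m.
Proof.
pose pi P : trinomial_algebra A m := piR m P.
have lin : linear pi by move=> c P Q; rewrite /pi rmorphD /= quot_pi_scale.
have mul : monoid_morphism pi.
  by split=> [|P Q]; rewrite /pi ?rmorph1 // rmorphM.
pose L := GRing.isLinear.Build K {mpoly K[nvars A m]} (trinomial_algebra A m) _ pi lin.
pose M := GRing.isMonoidMorphism.Build {mpoly K[nvars A m]}
  (trinomial_algebra A m) pi mul.
pose f : {lrmorphism {mpoly K[nvars A m]} -> trinomial_algebra A m} := HB.pack pi L M.
rewrite -(trinomial_relation_morph f) -[LHS]/(piR m (trinomial m i)).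
apply/eqP; rewrite -(rmorph0 (piR m)) -Quotient.idealrBE subr0.
apply/gen_idealP; exists (fun j => (j == i)%:R).
rewrite (bigD1 i) //= eqxx mul1r big1 ?addr0 // => j /negPf ->.
by rewrite mul0r.
Qed.

Section Coordinates.
Variables (aff : bool) (al be cU cV : I -> K) (u0 v0 : K).
Hypothesis coordA : plane_coordinates (A := tri_A A) aff al be cU cV u0 v0.

(** The equations in the algebra come from [plane_coordinates] over the algebra itself. The
    existence of points comes from the same statement over [K^o]: a solution of the block equations
    satisfies the trinomial relations, so evaluation at it factors through the quotient. *)
Lemma trinomial_presentation m :
  presentation aff al be (@variable_block m) (@variable_exponent m) (@generator m)
    (affine_form cU u0 (fun i => piR m (monT m i)))
    (affine_form cV v0 (fun i => piR m (monT m i))).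
Proof.
case: coordA => _ aff1 rel_coord coord_rel; split=> [f|i||x u v av xE].
- by exists (repr f); rewrite -generator_mmap reprK.
- rewrite mmap1_generator; apply: rel_coord => j; exact: trinomial_relation_pi.
- exact: aff1.
have monE i : (monT m i).@[x] = al i * u + be i * v.
  rewrite -xE mmap1_variable_block /monT rmorph_prod; apply: eq_bigr => j _.
  by rewrite rmorphXn /= mevalXU.
pose ev : {lrmorphism {mpoly K[nvars A m]} -> K^o} := meval x.
have [rel0 Uu Vv] := coord_rel K^o (fun i => (monT m i).@[x]) u v av monE.
have [|p pE] := @trinomial_point_of_zero K A m x.
  by move=> i; rewrite -[LHS]/(ev _) trinomial_relation_morph.
exists p; split=> [k||]; first by rewrite pE mevalXU.
  rewrite affine_form_morph -[RHS]Uu; congr (affine_form _ _ _).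
  by apply/funext => i; apply: pE.
rewrite affine_form_morph -[RHS]Vv; congr (affine_form _ _ _).
by apply/funext => i; apply: pE.
Qed.

End Coordinates.

End TrinomialPresentation.

Theorem theorem3p7 (K : closedFieldType) (charK : [pchar K]%R =i pred0)
    (A : trinomial_data K) (m : nat) :
  ~ rigid (trinomial_algebra A 0) ->
  finitely_many_orbits (trinomial_algebra A m).
Proof.
move=> /existsNP[D] /not_implyP[derD] /not_implyP[lnD] D_neq0.
have [aff [al [be [cU [cV [u0 [v0 coordA]]]]]]] := exists_plane_coordinates (tri_A A).
have be_neq0 : forall i, be i != 0 by case: coordA.
(* The second branch is a default value: for [m = 0] the right summand of [split] is the empty type
   ['I_0]. *)
pose j (k : 'I_(nvars A 0)) : 'I_(nvars A m) :=
  if split k is inl v then lshift m v else lshift m (cast_ord (addn0 _) k).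
pose e (k : 'I_(nvars A m)) : option 'I_(nvars A 0) :=
  if split k is inl v then Some (lshift 0 v) else None.
have i0 : 'I_(nblocks (tri_A A)) by case: (tri_A A) => *; exact: ord0.
have presm := trinomial_presentation coordA m.
have jl v : j (lshift 0 v) = lshift m v by rewrite /j (unsplitK (inl _)).
have blkj k : variable_block (j k) = variable_block k.
  by rewrite -(splitK k); case: (split k) => [v|[]] //;
    rewrite /= jl /variable_block !(unsplitK (inl _)).
have lj k : variable_exponent (j k) = variable_exponent k.
  by rewrite -(splitK k); case: (split k) => [v|[]] //;
    rewrite /= jl /variable_exponent !(unsplitK (inl _)).
have blkE : @variable_block K A m \o j = @variable_block K A 0 by apply/funext.
have lE : @variable_exponent K A m \o j = @variable_exponent K A 0 by apply/funext.
have pres0 := trinomial_presentation coordA 0; rewrite -blkE -lE in pres0.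
apply: (finitely_many_orbits_of_LND charK be_neq0
  (@variable_exponent_gt0 K A m) (@variable_block_surj K A m) presm _ _ _ pres0
  derD lnD i0 D_neq0 (e := e)).
- move=> k; rewrite -(splitK k); case: (split k) => [v|[]] //.
  by rewrite /= jl /e (unsplitK (inl _)).
- move=> k; rewrite -(splitK k) /e; case: (split k) => w.
    by rewrite (unsplitK (inl _)) /= jl.
  by rewrite (unsplitK (inr _)).
- by move=> k; rewrite /e /variable_block; case: split.
Qed.
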